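(* Let $K=1$, so that the single attribute $X$ is both public and private, and let there be no side information. Let $(D_1,E_1)$ and $(D_2,E_2)$ be distortion-privacy pairs with $D_2<D_1$ and $E_2<E_1$. Successive disclosure with pairs $(D_1,E_1)$ and $(D_2,E_2)$ is achievable if and only if there exists a conditional distribution $p(\hat x_1,\hat x_2|x)$ such that: (i) $\mathbb{E}[g(X,\hat X_k)]\le D_k$ for $k=1,2$; (ii) $R(D_k,E_k)=I(X;\hat X_k)$ for $k=1,2$; (iii) $X-\hat X_2-\hat X_1$ is a Markov chain, i.e. $p(\hat x_1,\hat x_2|x)=p(\hat x_2|x)\,p(\hat x_1|\hat x_2)$.
   Context: The source is $X^n$, i.i.d. with a known pmf on a finite alphabet, and $g$ is a per-letter distortion function. The rate-distortion-equivocation function is $R(D,E)=\inf\{I(X;\hat X): p(\hat x|x)\text{ with }\mathbb{E}[g(X,\hat X)]\le D,\ H(X|\hat X)\ge E\}$. It is the minimal rate of a code $W=F_E(X^n)$, $\hat X^n=F_D(W)$ satisfying $\mathbb{E}[\frac1n\sum_i g(X_i,\hat X_i)]\le D+\epsilon$ and $\frac1n H(X^n|W)\ge E-\epsilon$ asymptotically. Successive disclosure: a two-stage code consists of a first message $W_1$ of rate $R_1$ and a second message $W_2$ of rate $\Delta R$, both functions of $X^n$. A first decoder forms $\hat X_1^n$ from $W_1$, and a second decoder forms $\hat X_2^n$ from $(W_1,W_2)$. The requirements are $\mathbb{E}[\frac1n\sum_i g(X_i,\hat X_{k,i})]\le D_k+\epsilon$ for $k=1,2$, together with $\frac1n H(X^n|W_1)\ge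 E_1-\epsilon$ and $\frac1n H(X^n|W_1,W_2)\ge E_2-\epsilon$. Successive disclosure with pairs $(D_1,E_1),(D_2,E_2)$ is achievable if such codes exist for every $\epsilon>0$ with no rate loss, meaning $R_1=R(D_1,E_1)$ and $R_1+\Delta R=R(D_2,E_2)$. *)

(* Defs.v *)
From Stdlib Require Import Reals.
From mathcomp Require Import ssreflect ssrfun ssrbool eqtype ssrnat seq choice fintype tuple.
Set Implicit Arguments. Unset Strict Implicit. Unset Printing Implicit Defensive.
Local Open Scope R_scope.

Definition sumT (T : finType) (f : T -> R) : R :=
  foldr (fun t acc => f t + acc) 0 (enum T).

(* x ln x with the convention 0 ln 0 = 0; entropies in nats *)
Definition xlnx (x : R) : R := if Rlt_dec 0 x then x * ln x else 0.

Definition ent (T : finType) (p : T -> R) : R := - sumT (fun t => xlnx (p t)).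

Definition is_pmf (T : finType) (p : T -> R) : Prop :=
  (forall t, 0 <= p t) /\ sumT p = 1.

Definition is_channel (A B : finType) (W : A -> B -> R) : Prop :=
  forall a, is_pmf (W a).

Definition margL (A B : finType) (p : A * B -> R) (a : A) : R := sumT (fun b => p (a, b)).
Definition margR (A B : finType) (p : A * B -> R) (b : B) : R := sumT (fun a => p (a, b)).

Definition condEnt (A B : finType) (p : A * B -> R) : R := ent p - ent (margR p).
Definition mutInf (A B : finType) (p : A * B -> R) : R := ent (margL p) - condEnt p.

Definition jointCh (A B : finType) (P : A -> R) (W : A -> B -> R) : A * B -> R :=
  fun ab => P ab.1 * W ab.1 ab.2.

Definition expect (T : finType) (p : T -> R) (f : T -> R) : R := sumT (fun t => p t * f t).

Definition is_glb (S : R -> Prop) (m : R) : Prop :=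
  (forall x, S x -> m <= x) /\ (forall m', (forall x, S x -> m' <= x) -> m' <= m).

Definition RDE_set (X Xh : finType) (P : X -> R) (g : X -> Xh -> R) (D E : R) : R -> Prop :=
  fun r => exists Q : X -> Xh -> R, is_channel Q /\
    expect (jointCh P Q) (fun p => g p.1 p.2) <= D /\
    E <= condEnt (jointCh P Q) /\
    r = mutInf (jointCh P Q).

Definition is_RDE (X Xh : finType) (P : X -> R) (g : X -> Xh -> R) (D E r : R) : Prop :=
  is_glb (RDE_set P g D E) r.

Definition prodP (X : finType) (P : X -> R) (n : nat) (xs : n.-tuple X) : R :=
  foldr (fun x acc => P x * acc) 1 xs.

Definition detJoint (A B : finType) (p : A -> R) (f : A -> B) : A * B -> R :=
  fun ab => if f ab.1 == ab.2 then p ab.1 else 0.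

Definition avgdist (X Xh : finType) (g : X -> Xh -> R) (n : nat)
  (xs : n.-tuple X) (ys : n.-tuple Xh) : R :=
  / INR n * sumT (fun i : 'I_n => g (tnth xs i) (tnth ys i)).

Definition two_stage_code (X Xh : finType) (P : X -> R) (g : X -> Xh -> R) (n : nat)
  (R1 dR D1 E1 D2 E2 eps : R) : Prop :=
  exists (M1 M2 : nat) (F1 : n.-tuple X -> 'I_M1) (F2 : n.-tuple X -> 'I_M2)
         (G1 : 'I_M1 -> n.-tuple Xh) (G2 : 'I_M1 * 'I_M2 -> n.-tuple Xh),
    ln (INR M1) <= INR n * (R1 + eps) /\
    ln (INR M2) <= INR n * (dR + eps) /\
    expect (@prodP X P n) (fun xs => avgdist g xs (G1 (F1 xs))) <= D1 + eps /\
    expect (@prodP X P n) (fun xs => avgdist g xs (G2 (F1 xs, F2 xs))) <= D2 + eps /\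
    E1 - eps <= / INR n * condEnt (detJoint (@prodP X P n) F1) /\
    E2 - eps <= / INR n * condEnt (detJoint (@prodP X P n) (fun xs => (F1 xs, F2 xs))).

Definition succ_achievable (X Xh : finType) (P : X -> R) (g : X -> Xh -> R)
  (D1 E1 D2 E2 : R) : Prop :=
  exists R1 R2 : R, is_RDE P g D1 E1 R1 /\ is_RDE P g D2 E2 R2 /\
    forall eps, 0 < eps -> exists N : nat, forall n : nat, (N <= n)%N -> (0 < n)%N ->
      two_stage_code P g n R1 (R2 - R1) D1 E1 D2 E2 eps.

Definition ch1 (X Xh : finType) (Q : X -> Xh * Xh -> R) (x : X) (a : Xh) : R :=
  sumT (fun b => Q x (a, b)).
Definition ch2 (X Xh : finType) (Q : X -> Xh * Xh -> R) (x : X) (b : Xh) : R :=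
  sumT (fun a => Q x (a, b)).

(* Main.v *)
(* Since a finite R(D, E) is at most H(X) - E, and H(X^n | W) >= n H(X) - ln |W|, the equivocation
   constraints follow from the rate constraints, and the theorem reduces to successive refinement.

   Only if: averaging a code over its n letters gives a channel whose mutual informations are
   bounded by the rates; a limit point Q of these channels as eps -> 0 satisfies
   I(X; B) <= I(X; A, B) <= R2 <= I(X; B), and equality in Gibbs' inequality is the Markov property.

   If: draw cloud centres from p(a)^n and satellites from p(b|a)^n, with rates I(X; A) and
   I(X; A, B) - I(X; A) = I(X; B) - I(X; A).  The expected uncovered mass, derandomised codeword by
   codeword, is at most the atypical mass, which decays exponentially by Chernoff's bound, plus terms
   exp(- M / K) that are doubly exponentially small. *)
Require Import Defs.
From Stdlib Require Import Reals Lra Classical ClassicalEpsilon FunctionalExtensionality.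
From HB Require Import structures.
From mathcomp Require Import ssreflect ssrfun ssrbool eqtype ssrnat seq choice fintype finfun tuple bigop.
Set Implicit Arguments. Unset Strict Implicit. Unset Printing Implicit Defensive.
Local Open Scope R_scope.

(** A channel that meets the distortion constraint with mutual information at most R(D, E) has
    equivocation at least H(X) - R(D, E) >= E. It is therefore feasible and attains the infimum;
    this is where R2 <= I(X; B) comes from, and I(X; A) = R1 likewise. Mutual information sees a
    channel only where [P] is positive, so the Markov factorisation first appears multiplied by
    [P x], and the limit channel is then redefined off the support. In the other direction,
    typicality consists of four upper bounds: on two information densities and on two distortions.
    The density bounds are exactly what the covering argument consumes, and each of the four
    concerns a sum of n i.i.d. terms on a finite alphabet, which is what makes Chernoff's bound
    applicable. K is the exponential of n times a density threshold; the codebook exponent exceeds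
    that threshold by a fixed margin, so M / K itself grows exponentially. *)

HB.instance Definition _ := Monoid.isComLaw.Build R 0 Rplus
  (fun x y z => esym (Rplus_assoc x y z)) Rplus_comm Rplus_0_l.
HB.instance Definition _ := Monoid.isComLaw.Build R 1 Rmult
  (fun x y z => esym (Rmult_assoc x y z)) Rmult_comm Rmult_1_l.
HB.instance Definition _ := Monoid.isMulLaw.Build R 0 Rmult Rmult_0_l Rmult_0_r.
HB.instance Definition _ := Monoid.isAddLaw.Build R Rmult Rplus
  (fun x y z => Rmult_plus_distr_r x y z) (fun x y z => Rmult_plus_distr_l x y z).

Local Notation "\sum_ ( i : t ) F" := (\big[Rplus/0]_(i : t) F) : R_scope.
Local Notation "\sum_ ( i : t | P ) F" := (\big[Rplus/0]_(i : t | P%B) F) : R_scope.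
Local Notation "\sum_ i F" := (\big[Rplus/0]_i F) : R_scope.
Local Notation "\sum_ ( i | P ) F" := (\big[Rplus/0]_(i | P%B) F) : R_scope.
Local Notation "\sum_ ( i < n ) F" := (\big[Rplus/0]_(i < n) F) : R_scope.
Local Notation "\prod_ ( i < n ) F" := (\big[Rmult/1]_(i < n) F) : R_scope.

(** * Finite sums and products *)

Lemma sumTE (T : finType) (f : T -> R) : sumT f = \sum_t f t.
Proof. by rewrite /sumT -big_enum unlock. Qed.

Section FiniteSums.
Variable I : finType.
Implicit Types (P : pred I) (F G : I -> R).

Lemma sum_ge0 P F : (forall i, P i -> 0 <= F i) -> 0 <= \sum_(i | P i) F i.
Proof. by move=> F0; apply: (big_ind (Rle 0)) => //; [lra | move=> x y; lra]. Qed.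

Lemma sum_le P F G : (forall i, P i -> F i <= G i) ->
  \sum_(i | P i) F i <= \sum_(i | P i) G i.
Proof. by move=> FG; apply: (big_ind2 Rle) => //; [lra | move=> *; lra]. Qed.

Lemma sumrZ c P F : \sum_(i | P i) (c * F i) = c * \sum_(i | P i) F i.
Proof. by rewrite big_distrr. Qed.

Lemma sumlZ c P F : \sum_(i | P i) (F i * c) = (\sum_(i | P i) F i) * c.
Proof. by rewrite big_distrl. Qed.

Lemma sumrD P F G :
  \sum_(i | P i) (F i + G i) = \sum_(i | P i) F i + \sum_(i | P i) G i.
Proof. exact: big_split. Qed.

Lemma sumrN P F : \sum_(i | P i) (- F i) = - \sum_(i | P i) F i.
Proof. by apply: (big_rec2 (fun x y => x = - y)); [lra | move=> i x y _ ->; lra]. Qed.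

Lemma sumrB P F G :
  \sum_(i | P i) (F i - G i) = \sum_(i | P i) F i - \sum_(i | P i) G i.
Proof. by rewrite sumrD sumrN. Qed.

Lemma sum_ge_term F i : (forall j, 0 <= F j) -> F i <= \sum_j F j.
Proof.
move=> F0; rewrite (bigD1 i) //=.
have := @sum_ge0 (fun j => j != i) F (fun j _ => F0 j); lra.
Qed.

Lemma sum_eq0P F : (forall j, 0 <= F j) -> \sum_j F j <= 0 -> forall i, F i = 0.
Proof. by move=> F0 s0 i; have := F0 i; have := sum_ge_term i F0; lra. Qed.

Lemma sum_le_subset P F : (forall i, 0 <= F i) -> \sum_(i | P i) F i <= \sum_i F i.
Proof.
move=> F0; rewrite big_mkcond; apply: sum_le => i _; case: (P i) => //; lra.
Qed.

Lemma sum_const c : \sum_(i : I) c = INR #|I| * c.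
Proof.
rewrite big_const; elim: #|I| => [|n IH]; first by rewrite /=; lra.
by rewrite iterS IH S_INR; lra.
Qed.
End FiniteSums.

Lemma prod_gt0 n (F : 'I_n -> R) : (forall i, 0 < F i) -> 0 < \prod_(i < n) F i.
Proof.
move=> F0; apply: (big_ind (Rlt 0)) => //; [lra | exact: Rmult_lt_0_compat].
Qed.

Lemma prod_ge0 n (F : 'I_n -> R) : (forall i, 0 <= F i) -> 0 <= \prod_(i < n) F i.
Proof.
move=> F0; apply: (big_ind (Rle 0)) => //; [lra | exact: Rmult_le_pos].
Qed.

Lemma prod_le1 n (F : 'I_n -> R) :
  (forall i, 0 <= F i <= 1) -> \prod_(i < n) F i <= 1.
Proof.
move=> F0; suff : 0 <= \prod_(i < n) F i <= 1 by case.
by apply: (big_ind (fun x => 0 <= x <= 1)) => //; [lra | move=> x y *; nra].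
Qed.

Lemma prod_pos_factor n (F : 'I_n -> R) i :
  (forall j, 0 <= F j) -> 0 < \prod_(j < n) F j -> 0 < F i.
Proof.
move=> F0; rewrite (bigD1 i) //=; case: (F0 i) => // <-; rewrite Rmult_0_l; lra.
Qed.

Lemma prod_const n c : \prod_(i < n) c = c ^ n.
Proof. by rewrite big_const card_ord; elim: n => //= n ->. Qed.

Lemma ln_prod n (F : 'I_n -> R) :
  (forall i, 0 < F i) -> ln (\prod_(i < n) F i) = \sum_(i < n) ln (F i).
Proof.
move=> F0; suff [] : 0 < \prod_(i < n) F i /\ ln (\prod_(i < n) F i) = \sum_(i < n) ln (F i) by [].
apply: (big_ind2 (fun x y => 0 < x /\ ln x = y)); first by rewrite ln_1; split; lra.
- move=> x1 x2 y1 y2 [x0 <-] [y0 <-]; split; first exact: Rmult_lt_0_compat.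
  exact: ln_mult.
- by [].
Qed.

Lemma exp_sum n (F : 'I_n -> R) : exp (\sum_(i < n) F i) = \prod_(i < n) exp (F i).
Proof. by apply: (big_morph exp); [exact: exp_plus | exact: exp_0]. Qed.

(** Distributivity over functions ['I_n -> T], transported to tuples. The factor depends on the
    position so that the identity also covers one constrained coordinate, or a memoryless channel
    with a fixed input sequence. *)
Lemma sum_tuple_prod (T : finType) n (h : 'I_n -> T -> R) :
  \sum_(t : n.-tuple T) \prod_(i < n) h i (tnth t i) = \prod_(i < n) \sum_z h i z.
Proof.
rewrite bigA_distr_bigA /= (reindex (@tuple_of_finfun T n)) /=; last first.
  by exists (@finfun_of_tuple T n) => t _; [exact: tuple_of_finfunK | exact: finfun_of_tupleK].
by apply: eq_bigr => f _; apply: eq_bigr => i _; rewrite tnth_mktuple.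
Qed.

Lemma prodPE (X : finType) (P : X -> R) n (xs : n.-tuple X) :
  prodP P xs = \prod_(i < n) P (tnth xs i).
Proof. by rewrite -(big_tuple _ _ xs xpredT P) unlock. Qed.

Lemma sum_pair (A B : finType) (f : A * B -> R) : \sum_ab f ab = \sum_a \sum_b f (a, b).
Proof. by rewrite pair_bigA; apply: eq_bigr => -[]. Qed.

(** * Entropy and mutual information *)

(* [ln] is 0 on nonpositive reals. *)
Lemma xlnxE x : xlnx x = x * ln x.
Proof.
rewrite /xlnx; case: Rlt_dec => // x0.
by rewrite /ln; case: Rlt_dec => //= _; rewrite Rmult_0_r.
Qed.

Lemma ln_quot x y : 0 < x -> 0 < y -> ln (x / y) = ln x - ln y.
Proof.
by move=> x0 y0; rewrite /Rdiv ln_mult ?ln_Rinv //; exact: Rinv_0_lt_compat.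
Qed.

Lemma ln_le_sub1 x : 0 < x -> ln x <= x - 1.
Proof.
move=> x0; case: (Req_dec (ln x) 0) => [l0|/exp_ineq1]; last by rewrite exp_ln //; lra.
by move: (exp_ln _ x0); rewrite l0 exp_0; lra.
Qed.

Lemma ln_eq_sub1 x : 0 < x -> x - 1 <= ln x -> x = 1.
Proof.
move=> x0 h; case: (Req_dec (ln x) 0) => [l0|/exp_ineq1].
  by rewrite -(exp_ln _ x0) l0 exp_0.
rewrite exp_ln //; lra.
Qed.

Section Gibbs.
Variables p q : R.
Hypotheses (p0 : 0 <= p) (q0 : 0 <= q) (pq : 0 < p -> 0 < q).

(** This is ln t <= t - 1 at t = q / p. Keeping Gibbs' inequality termwise lets the equality case be
    read off one letter at a time. *)
Lemma gibbs : p - q <= p * (ln p - ln q).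
Proof.
case: p0 => [pp|<-]; last by lra.
have qq := pq pp; have := @ln_le_sub1 (q / p) (Rdiv_lt_0_compat _ _ qq pp).
rewrite ln_quot // => h.
have -> : p - q = p * (1 - q / p) by field; lra.
apply: Rmult_le_compat_l; lra.
Qed.

Lemma gibbs_eq : p * (ln p - ln q) <= p - q -> p = q.
Proof.
case: p0 => [pp|<-]; last by lra.
have qq := pq pp => h.
suff e : q / p = 1 by have : q = q / p * p; [field; lra | rewrite e; lra].
apply: ln_eq_sub1; first exact: Rdiv_lt_0_compat.
rewrite ln_quot //; apply: (Rmult_le_reg_l p) => //.
have -> : p * (q / p - 1) = q - p by field; lra.
lra.
Qed.
End Gibbs.

Lemma pmf_sum (T : finType) (p : T -> R) : is_pmf p -> \sum_t p t = 1.
Proof. by case=> _; rewrite sumTE. Qed.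

Lemma pmf_le1 (T : finType) (p : T -> R) t : is_pmf p -> p t <= 1.
Proof. by move=> pP; rewrite -(pmf_sum pP); apply: sum_ge_term; case: pP. Qed.

Lemma pmf_card (T : finType) (p : T -> R) : is_pmf p -> (0 < #|T|)%N.
Proof.
move=> pP; rewrite lt0n; apply/negP => /eqP T0; have := pmf_sum pP.
rewrite big1; first by lra.
by move=> i _; have := fintype0 i; rewrite T0.
Qed.

Lemma entE (T : finType) (p : T -> R) : ent p = - \sum_t p t * ln (p t).
Proof. by rewrite /ent sumTE; congr (- _); apply: eq_bigr => t _; rewrite xlnxE. Qed.

Lemma eq_ent (T : finType) (p q : T -> R) : p =1 q -> ent p = ent q.
Proof. by move=> e; rewrite !entE; congr (- _); apply: eq_bigr => t _; rewrite e. Qed.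

(** Gibbs' inequality against the uniform law. *)
Lemma ent_le_card (T : finType) (p : T -> R) : is_pmf p -> ent p <= ln (INR #|T|).
Proof.
move=> pP; have c0 : 0 < INR #|T| by apply/lt_0_INR/ltP/(pmf_card pP).
have ic0 := Rinv_0_lt_compat _ c0.
have : \sum_t (p t - / INR #|T|) <= \sum_t (p t * (ln (p t) - ln (/ INR #|T|))).
  by apply: sum_le => t _; apply: gibbs => //; [case: pP | lra].
have -> : \sum_t (p t * (ln (p t) - ln (/ INR #|T|)))
       = \sum_t (p t * ln (p t)) + \sum_t (p t * ln (INR #|T|)).
  by rewrite -sumrD; apply: eq_bigr => t _; rewrite ln_Rinv //; lra.
rewrite entE sumrB (pmf_sum pP) sum_const sumlZ (pmf_sum pP) Rinv_r; lra.
Qed.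

Section Channels.
Variables (X : finType) (P : X -> R).
Hypothesis PP : is_pmf P.
Let P0 x : 0 <= P x. Proof. by case: PP. Qed.

Definition outMarg (B : finType) (W : X -> B -> R) (b : B) : R := \sum_x P x * W x b.

Lemma outMarg_ge0 (B : finType) (W : X -> B -> R) b : is_channel W -> 0 <= outMarg W b.
Proof. by move=> Wc; apply: sum_ge0 => x _; apply: Rmult_le_pos => //; case: (Wc x). Qed.

Lemma outMarg_ge (B : finType) (W : X -> B -> R) x b :
  is_channel W -> P x * W x b <= outMarg W b.
Proof.
move=> Wc; apply: (@sum_ge_term _ (fun x => P x * W x b)) => y.
by apply: Rmult_le_pos => //; case: (Wc y).
Qed.

Lemma sum_channel (B : finType) (W : X -> B -> R) (h : X -> R) : is_channel W ->
  \sum_x \sum_b h x * W x b = \sum_x h x.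
Proof. by move=> Wc; apply: eq_bigr => x _; rewrite sumrZ (pmf_sum (Wc x)) Rmult_1_r. Qed.

Lemma outMarg_pmf (B : finType) (W : X -> B -> R) : is_channel W -> is_pmf (outMarg W).
Proof.
move=> Wc; split=> [b|]; first exact: outMarg_ge0.
by rewrite sumTE exchange_big /= sum_channel ?pmf_sum.
Qed.

Lemma expectE (B : finType) (W : X -> B -> R) (f : X * B -> R) :
  expect (jointCh P W) f = \sum_x \sum_b P x * W x b * f (x, b).
Proof. by rewrite /expect sumTE pair_bigA; apply: eq_bigr => -[x b]. Qed.

Lemma margL_jointCh (B : finType) (W : X -> B -> R) :
  is_channel W -> margL (jointCh P W) =1 P.
Proof.
by move=> Wc x; rewrite /margL sumTE /jointCh /= sumrZ (pmf_sum (Wc x)) Rmult_1_r.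
Qed.

Lemma margR_jointCh (B : finType) (W : X -> B -> R) :
  margR (jointCh P W) =1 outMarg W.
Proof. by move=> b; rewrite /margR sumTE. Qed.

Lemma condEnt_jointCh (B : finType) (W : X -> B -> R) : is_channel W ->
  condEnt (jointCh P W) = ent P - mutInf (jointCh P W).
Proof. by move=> Wc; rewrite /mutInf (eq_ent (margL_jointCh Wc)); lra. Qed.

(** The mean of the information density. Terms of probability 0 carry the factor 0, so the default
    value of [ln] there is harmless. *)
Lemma mutInfE (B : finType) (W : X -> B -> R) : is_channel W ->
  mutInf (jointCh P W) = \sum_x \sum_b P x * W x b * (ln (W x b) - ln (outMarg W b)).
Proof.
move=> Wc; rewrite /mutInf /condEnt (eq_ent (margL_jointCh Wc)) (eq_ent (@margR_jointCh B W)).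
rewrite !entE.
have -> : \sum_t jointCh P W t * ln (jointCh P W t)
        = \sum_x \sum_b P x * ln (P x) * W x b + \sum_x \sum_b P x * W x b * ln (W x b).
  rewrite !pair_bigA -sumrD; apply: eq_bigr => -[x b] _; rewrite /jointCh /=.
  case: (P0 x) => [px|<-]; last by lra.
  by case: (Wc x) => /(_ b) [wx|<-] _; [rewrite ln_mult //; lra | lra].
have -> : \sum_b outMarg W b * ln (outMarg W b)
        = \sum_x \sum_b P x * W x b * ln (outMarg W b).
  by rewrite exchange_big; apply: eq_bigr => b _; rewrite -sumlZ.
have -> : \sum_x \sum_b P x * W x b * (ln (W x b) - ln (outMarg W b))
        = \sum_x \sum_b P x * W x b * ln (W x b)
          - \sum_x \sum_b P x * W x b * ln (outMarg W b).
  by rewrite !pair_bigA -sumrB; apply: eq_bigr => xb _; rewrite Rmult_minus_distr_l.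
rewrite sum_channel //; lra.
Qed.

End Channels.

(** * Single-letterization *)

Lemma prodP_ge0 (X : finType) (P : X -> R) n (xs : n.-tuple X) : is_pmf P -> 0 <= prodP P xs.
Proof. by case=> P0 _; rewrite prodPE; apply: prod_ge0. Qed.

Lemma prodP_pmf (X : finType) (P : X -> R) n : is_pmf P -> is_pmf (@prodP X P n).
Proof.
move=> PP; split=> [xs|]; first exact: prodP_ge0.
rewrite sumTE; under eq_bigr do rewrite prodPE.
by rewrite (sum_tuple_prod (fun _ => P)) big1 // => i _; exact: pmf_sum.
Qed.

Lemma prodP_marginal (X : finType) (P : X -> R) n (i : 'I_n) x : is_pmf P ->
  \big[Rplus/0]_(xs : n.-tuple X | tnth xs i == x) prodP P xs = P x.
Proof.
move=> PP; rewrite big_mkcond /=.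
(* [h] forbids every letter but [x] at position [i]: the product vanishes unless [tnth xs i = x],
   and the other positions sum to 1. *)
pose h j z := if (j == i) && (z != x) then 0 else P z.
transitivity (\sum_(xs : n.-tuple X) \prod_(j < n) h j (tnth xs j)).
  apply: eq_bigr => xs _; case: eqP => [e|/eqP ne].
    rewrite prodPE; apply: eq_bigr => j _; rewrite /h.
    by case: eqP => //= ->; rewrite e eqxx.
  by rewrite (bigD1 i) //= /h eqxx ne Rmult_0_l.
rewrite sum_tuple_prod (bigD1 i) //= [X in _ * X]big1 => [|j ji].
  rewrite Rmult_1_r (bigD1 x) //= {1}/h eqxx eqxx /= big1 ?Rplus_0_r // => z zx.
  by rewrite /h eqxx zx.
by rewrite -(pmf_sum PP); apply: eq_bigr => z _; rewrite /h (negPf ji).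
Qed.

Lemma sum_fiber2 (T A B : finType) (w : T -> R) (t : T -> A) (u : T -> B) (f : A -> B -> R) :
  \sum_a \sum_b (\sum_(s | (t s == a) && (u s == b)) w s) * f a b
  = \sum_s w s * f (t s) (u s).
Proof.
rewrite (partition_big (fun s => (t s, u s)) xpredT) //= pair_bigA.
apply: eq_bigr => -[a b] _ /=; rewrite -sumlZ; apply: eq_big => s; first by rewrite xpair_eqE.
by case/andP=> /eqP -> /eqP ->.
Qed.

Section SingleLetter.
Variables (X W C : finType) (P : X -> R) (n : nat).
Variables (F : n.-tuple X -> W) (c : W -> 'I_n -> C).
Hypotheses (PP : is_pmf P) (n0 : (0 < n)%N).

Let nR0 : 0 < INR n. Proof. exact/lt_0_INR/ltP. Qed.
Let invn0 : 0 < / INR n. Proof. exact: Rinv_0_lt_compat. Qed.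

(** The conditional law of the output letter given the source letter at a uniformly random position,
    characterised by test functions. In this form it passes to a marginal of [Q] by restricting the
    test functions. *)
Definition isAvgChannel (Q : X -> C -> R) : Prop := forall f : X -> C -> R,
  \sum_x \sum_d P x * Q x d * f x d
  = / INR n * \sum_(xs : n.-tuple X) prodP P xs * \sum_i f (tnth xs i) (c (F xs) i).

Let avgJoint x d : R := / INR n *
  \sum_i \big[Rplus/0]_(xs : n.-tuple X | (tnth xs i == x) && (c (F xs) i == d)) prodP P xs.

Let avgJoint_ge0 x d : 0 <= avgJoint x d.
Proof.
apply: Rmult_le_pos; first lra.
by apply: sum_ge0 => i _; apply: sum_ge0 => xs _; exact: prodP_ge0.
Qed.

Let avgJoint_margL x : \sum_d avgJoint x d = P x.
Proof.
rewrite sumrZ exchange_big /=.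
rewrite (eq_bigr (fun=> P x)) => [|i _].
  by rewrite sum_const card_ord -Rmult_assoc Rinv_l ?Rmult_1_l //; lra.
rewrite -(prodP_marginal i x PP).
by rewrite [RHS](partition_big (fun xs => c (F xs) i) xpredT).
Qed.

Let avgJoint_mean (f : X -> C -> R) :
  \sum_x \sum_d avgJoint x d * f x d
  = / INR n * \sum_(xs : n.-tuple X) prodP P xs * \sum_i f (tnth xs i) (c (F xs) i).
Proof.
transitivity (/ INR n * \sum_i \sum_x \sum_d
    (\big[Rplus/0]_(xs : n.-tuple X | (tnth xs i == x) && (c (F xs) i == d)) prodP P xs) * f x d).
  rewrite [in RHS]exchange_big /= -sumrZ; apply: eq_bigr => x _.
  rewrite [in RHS]exchange_big /= -sumrZ; apply: eq_bigr => d _.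
  by rewrite sumlZ -Rmult_assoc.
congr (_ * _); under eq_bigr do rewrite sum_fiber2.
by rewrite exchange_big; apply: eq_bigr => xs _; rewrite sumrZ.
Qed.

Lemma avgChannel_exists : exists2 Q, is_channel Q & isAvgChannel Q.
Proof.
(* Where [P x = 0] the output law serves as default: it is a pmf available without choosing a letter
   of [C]. *)
pose Q x d := if Rlt_dec 0 (P x) then / P x * avgJoint x d else \sum_y avgJoint y d.
exists Q => [x|f]; last first.
  rewrite -avgJoint_mean; apply: eq_bigr => x _; apply: eq_bigr => d _; congr (_ * _).
  rewrite /Q; case: Rlt_dec => /= [px|npx]; first by rewrite -Rmult_assoc Rinv_r ?Rmult_1_l //; lra.
  have p0 : P x = 0 by case: PP => /(_ x); lra.
  rewrite p0 Rmult_0_l; apply/esym/(@sum_eq0P _ (avgJoint x)) => //.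
  by rewrite avgJoint_margL; lra.
rewrite /Q; case: Rlt_dec => /= [px|npx]; split=> [d|].
- by apply: Rmult_le_pos => //; left; exact: Rinv_0_lt_compat.
- by rewrite sumTE sumrZ avgJoint_margL; field; lra.
- exact: sum_ge0.
by rewrite sumTE exchange_big /= -(pmf_sum PP); apply: eq_bigr => x' _; exact: avgJoint_margL.
Qed.

(* With Z the product of the letterwise likelihood ratios Q(x_i, c_i) / r(c_i),
   n I(X; C) = E[ln Z] <= ln |W| + E[Z] / |W| - 1, and E[Z] <= |W| because for each
   fixed w the backward channels P(x) Q(x, c_i(w)) / r(c_i(w)) have total mass at most 1. *)
Lemma avgChannel_mutInf_le Q : is_channel Q -> isAvgChannel Q ->
  mutInf (jointCh P Q) <= / INR n * ln (INR #|W|).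
Proof.
move=> Qc avg; rewrite mutInfE // avg; apply: Rmult_le_compat_l; first lra.
have P0 x : 0 <= P x by case: PP.
have Q0 x d : 0 <= Q x d by case: (Qc x).
set r := outMarg P Q; have r0 d : 0 <= r d by exact: outMarg_ge0.
(* A sequence of positive probability meets only letter pairs of positive joint mass, as seen by
   testing [avg] on the indicator of the pair. This justifies splitting the logarithms below. *)
have supp xs i : 0 < prodP P xs -> 0 < P (tnth xs i) * Q (tnth xs i) (c (F xs) i).
  move=> pxs; set x := tnth xs i; set d := c (F xs) i.
  pose f y e := if (y == x) && (e == d) then 1 else 0.
  have f0 y e : 0 <= f y e by rewrite /f; case: ifP => _; lra.
  have := avg f; rewrite (bigD1 x) //= [X in _ + X]big1 => [|y yx]; last first.
    by apply: big1 => e _; rewrite /f (negPf yx) Rmult_0_r.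
  rewrite Rplus_0_r (bigD1 d) //= [X in _ + X]big1 => [|e ed]; last first.
    by rewrite /f (negPf ed) andbF Rmult_0_r.
  rewrite {1}/f !eqxx Rmult_1_r Rplus_0_r => ->.
  apply: Rmult_lt_0_compat => //; apply: Rlt_le_trans pxs _.
  pose G (ys : n.-tuple X) := prodP P ys * \sum_j f (tnth ys j) (c (F ys) j).
  apply: (Rle_trans _ (G xs)); last first.
    apply: sum_ge_term => ys.
    by apply: Rmult_le_pos; [exact: prodP_ge0 | exact: sum_ge0].
  rewrite /G -[X in X <= _]Rmult_1_r; apply: Rmult_le_compat_l; first exact: prodP_ge0.
  have := @sum_ge_term _ (fun i => f (tnth xs i) (c (F xs) i)) i (fun _ => f0 _ _).
  by rewrite {1}/f !eqxx.
have W0 : 0 < INR #|W|.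
  by apply/lt_0_INR/ltP/card_gt0P; case/card_gt0P: (pmf_card (prodP_pmf n PP)) => xs _; exists (F xs).
set N := INR #|W| in W0 *.
pose Z (xs : n.-tuple X) := \prod_(i < n) (Q (tnth xs i) (c (F xs) i) / r (c (F xs) i)).
(* The term [w = F xs] of the sum of [Y xs w] over [w] is [prodP P xs * Z xs]. Summing over all [w]
   frees the codeword from [xs], so the sum over [xs] factorises. *)
pose Y (xs : n.-tuple X) w := \prod_(i < n) (P (tnth xs i) * Q (tnth xs i) (c w i) / r (c w i)).
have Y0 xs w : 0 <= Y xs w.
  apply: prod_ge0 => i; have := r0 (c w i) => -[rp|<-].
    by apply: Rmult_le_pos; [exact: Rmult_le_pos | left; exact: Rinv_0_lt_compat].
  by rewrite /Rdiv Rinv_0; lra.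
have meanZ : \sum_(xs : n.-tuple X) prodP P xs * Z xs <= N.
  apply: (Rle_trans _ (\sum_(xs : n.-tuple X) \sum_w Y xs w)).
    apply: sum_le => xs _; apply: Rle_trans (sum_ge_term (F xs) _); last by [].
    by rewrite prodPE /Z -big_split; right; apply: eq_bigr => i _; rewrite /= /Rdiv Rmult_assoc.
  rewrite exchange_big /= -[N]Rmult_1_r -sum_const; apply: sum_le => w _.
  rewrite (sum_tuple_prod (fun i x => P x * Q x (c w i) / r (c w i))); apply: prod_le1 => i.
  rewrite /Rdiv sumlZ -/(outMarg P Q (c w i)) -/r; case: (r0 (c w i)) => [rp|<-]; last by lra.
  by rewrite Rinv_r; lra.
apply: (Rle_trans _ (\sum_(xs : n.-tuple X)
    (prodP P xs * (ln N - 1) + prodP P xs * Z xs * / N))); last first.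
  rewrite sumrD !sumlZ (pmf_sum (prodP_pmf n PP)).
  apply: (Rle_trans _ (1 * (ln N - 1) + N * / N)); last by rewrite Rinv_r; lra.
  apply/Rplus_le_compat_l/Rmult_le_compat_r/meanZ.
  by left; exact: Rinv_0_lt_compat.
apply: sum_le => xs _; case: (prodP_ge0 xs PP) => [pxs|<-]; last by lra.
have Qp i : 0 < Q (tnth xs i) (c (F xs) i).
  by have := supp _ i pxs; have := P0 (tnth xs i); have := Q0 (tnth xs i) (c (F xs) i) => *; nra.
have rp i : 0 < r (c (F xs) i).
  by apply: Rlt_le_trans (supp _ i pxs) _; exact: outMarg_ge.
have Zp : 0 < Z xs by apply: prod_gt0 => i; exact: Rdiv_lt_0_compat.
have -> : \sum_i (ln (Q (tnth xs i) (c (F xs) i)) - ln (r (c (F xs) i))) = ln (Z xs).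
  rewrite ln_prod => [|i]; last exact: Rdiv_lt_0_compat.
  by apply: eq_bigr => i _; rewrite ln_quot.
have := @ln_le_sub1 (Z xs / N) (Rdiv_lt_0_compat _ _ Zp W0); rewrite ln_quot // => h.
rewrite Rmult_assoc -Rmult_plus_distr_l; apply: Rmult_le_compat_l; rewrite /Rdiv in h *; lra.
Qed.

End SingleLetter.

(** * Limits of channels *)

Lemma cv_const c : Un_cv (fun _ => c) c.
Proof. by move=> e e0; exists 0%N => n _; rewrite /Rdist Rminus_diag Rabs_R0. Qed.

Lemma eq_cv u v l : u =1 v -> Un_cv u l -> Un_cv v l.
Proof. by move=> uv ul e /ul [N h]; exists N => n /h; rewrite uv. Qed.

Lemma cv_subseq u l (phi : nat -> nat) : (forall k, le k (phi k)) ->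
  Un_cv u l -> Un_cv (fun k => u (phi k)) l.
Proof.
by move=> hphi ul e /ul [N h]; exists N => k hk; apply: h; apply: Nat.le_trans (hphi k).
Qed.

Lemma cv_sum (T : finType) (u : nat -> T -> R) (l : T -> R) :
  (forall t, Un_cv (fun k => u k t) (l t)) ->
  Un_cv (fun k => \sum_t u k t) (\sum_t l t).
Proof.
move=> ul; elim: (index_enum T) => [|t s IH].
  by rewrite big_nil; apply: eq_cv (cv_const 0) => k; rewrite big_nil.
rewrite big_cons; apply: eq_cv (CV_plus _ _ _ _ (ul t) IH) => k.
by rewrite big_cons.
Qed.

(** Continuity of x ln x at 0 in quantitative form: ln t <= t - 1 at t = 1 / sqrt x bounds - x ln x
    by 2 sqrt x, and at t = x it bounds x ln x by x * x. *)
Lemma Rabs_xlnx_le x : 0 <= x -> Rabs (x * ln x) <= 2 * sqrt x + x * x.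
Proof.
case=> [x0|<-]; last by rewrite Rmult_0_l Rabs_R0 sqrt_0; lra.
have s0 := sqrt_lt_R0 _ x0; have sx : sqrt x * sqrt x = x by apply: sqrt_sqrt; lra.
have l1 := ln_le_sub1 x0.
have l2 : ln x = 2 * ln (sqrt x) by rewrite -{1}sx ln_mult //; lra.
have l3 := ln_le_sub1 (Rinv_0_lt_compat _ s0).
rewrite ln_Rinv // in l3.
have l4 : sqrt x - x >= x * - ln (sqrt x).
  have -> : sqrt x - x = x * (/ sqrt x - 1) by rewrite -{2 3}sx; field; lra.
  by apply/Rle_ge/Rmult_le_compat_l => //; lra.
apply: Rabs_le; split; first by rewrite l2; nra.
nra.
Qed.

Lemma cv_xlnx u l : (forall k, 0 <= u k) -> Un_cv u l ->
  Un_cv (fun k => u k * ln (u k)) (l * ln l).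
Proof.
move=> u0 ul; have : 0 <= l by apply: Rle_cv_lim (cv_const 0) ul.
case=> [l0|l0].
  apply: CV_mult => //; apply: continuity_seq ul.
  by apply: derivable_continuous_pt; exists (/ l); exact: derivable_pt_lim_ln.
rewrite -l0 in ul *; rewrite Rmult_0_l.
have : Un_cv (fun k => 2 * sqrt (u k) + u k * u k) (2 * sqrt 0 + 0 * 0).
  apply: CV_plus; last exact: CV_mult.
  apply: CV_mult; first exact: cv_const.
  by apply: continuity_seq ul; apply: continuity_pt_sqrt; lra.
rewrite sqrt_0 => bnd e /bnd [N h]; exists N => n /h; rewrite /Rdist.
by have := Rabs_xlnx_le (u0 n); rewrite !Rminus_0_r; split_Rabs; lra.
Qed.

Lemma cv_ent (T : finType) (p : nat -> T -> R) (q : T -> R) :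
  (forall k t, 0 <= p k t) -> (forall t, Un_cv (fun k => p k t) (q t)) ->
  Un_cv (fun k => ent (p k)) (ent q).
Proof.
move=> p0 pq; rewrite entE; apply: (@eq_cv (fun k => - \sum_t p k t * ln (p k t))).
  by move=> k; rewrite entE.
by apply: CV_opp; apply: cv_sum => t; apply: cv_xlnx.
Qed.

Lemma cv_mutInf (A B : finType) (p : nat -> A * B -> R) (q : A * B -> R) :
  (forall k t, 0 <= p k t) -> (forall t, Un_cv (fun k => p k t) (q t)) ->
  Un_cv (fun k => mutInf (p k)) (mutInf q).
Proof.
move=> p0 pq; rewrite /mutInf /condEnt.
have hs (T : finType) (u : nat -> T -> R) (l : T -> R) :
    (forall t, Un_cv (fun k => u k t) (l t)) -> Un_cv (fun k => sumT (u k)) (sumT l).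
  by move=> ul; rewrite sumTE; apply: eq_cv (cv_sum ul) => k; rewrite sumTE.
have ge0 (T : finType) (u : T -> R) : (forall t, 0 <= u t) -> 0 <= sumT u.
  by move=> h; rewrite sumTE; apply: sum_ge0.
apply: CV_minus; first by apply: cv_ent => [k t|t]; [exact: ge0 | exact: hs].
by apply: CV_minus; apply: cv_ent => // [k t|t]; [exact: ge0 | exact: hs].
Qed.

Lemma cv_expect (T : finType) (p : nat -> T -> R) (q f : T -> R) :
  (forall t, Un_cv (fun k => p k t) (q t)) ->
  Un_cv (fun k => expect (p k) f) (expect q f).
Proof.
move=> pq; rewrite /expect sumTE.
apply: (@eq_cv (fun k => \sum_t p k t * f t)) => [k|]; first by rewrite sumTE.
by apply: cv_sum => t; apply: CV_mult => //; exact: cv_const.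
Qed.

Lemma cv_harmonic : Un_cv (fun k => / INR k.+1) 0.
Proof.
move=> e e0; have [N [hN N0]] := archimed_cor1 e e0; exists N => n hn.
rewrite /Rdist Rminus_0_r Rabs_pos_eq; last by left; apply/Rinv_0_lt_compat/lt_0_INR/Nat.lt_0_succ.
apply: Rle_lt_trans hN; apply: Rinv_le_contravar; first exact: lt_0_INR.
by apply: le_INR; apply: Nat.le_trans hn _; exact: Nat.le_succ_diag_r.
Qed.

(** [phi k] is an index past [k] whose value is within 1 / (k + 1) of an adherence value. The bound
    [k <= phi k] is the notion of subsequence used throughout: it preserves limits and is stable
    under composition. *)
Lemma bounded_cv_subseq (u : nat -> R) : (forall k, 0 <= u k <= 1) ->
  exists phi l, (forall k, le k (phi k)) /\ Un_cv (fun k => u (phi k)) l.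
Proof.
move=> u01; have [l hl] := Bolzano_Weierstrass u _ (compact_P3 0 1) u01.
have ex k : exists p, le k p /\ Rabs (u p - l) < / INR k.+1.
  have k0 : 0 < / INR k.+1 by apply/Rinv_0_lt_compat/lt_0_INR/Nat.lt_0_succ.
  by apply: (hl (fun x => Rabs (x - l) < / INR k.+1) k); exists (mkposreal _ k0).
pose phi k := proj1_sig (constructive_indefinite_description _ (ex k)).
have hphi k : le k (phi k) /\ Rabs (u (phi k) - l) < / INR k.+1.
  exact: proj2_sig (constructive_indefinite_description _ (ex k)).
exists phi, l; split=> [k|e e0]; first by case: (hphi k).
have [N hN] := cv_harmonic e0; exists N => n /hN; rewrite /Rdist Rminus_0_r.
by case: (hphi n) => _; split_Rabs; lra.
Qed.

(** One extraction per element of [T]; the limits already obtained survive the later extractions. *)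
Lemma bounded_cv_subseq_fin (T : finType) (u : nat -> T -> R) :
  (forall k t, 0 <= u k t <= 1) ->
  exists phi l, (forall k, le k (phi k)) /\ forall t, Un_cv (fun k => u (phi k) t) (l t).
Proof.
move=> u01.
suff [phi [hphi h]] : exists phi, (forall k, le k (phi k)) /\
    forall t, t \in enum T -> exists l, Un_cv (fun k => u (phi k) t) l.
  have ex t : exists l, Un_cv (fun k => u (phi k) t) l by apply: h; rewrite mem_enum.
  exists phi, (fun t => proj1_sig (constructive_indefinite_description _ (ex t))).
  by split=> // t; exact: proj2_sig (constructive_indefinite_description _ (ex t)).
elim: (enum T) => [|t s [phi [hphi IH]]]; first by exists id.
have [psi [l [hpsi hl]]] := @bounded_cv_subseq (fun k => u (phi k) t) (fun k => u01 _ _).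
exists (fun k => phi (psi k)); split=> [k|t']; first exact: Nat.le_trans (hpsi k) (hphi _).
rewrite inE => /orP [/eqP ->|/IH [l' hl']]; first by exists l.
by exists l'; apply: (cv_subseq (u := fun k => u (phi k) t')).
Qed.

(** * Coarsening the output of a channel *)

(** The common form of the two marginals of a pair channel ([fst], [snd]) and of the constant
    output, so that one data-processing argument serves them all. *)
Definition coarsen (X B C : finType) (phi : B -> C) (W : X -> B -> R) (x : X) (c : C) : R :=
  \sum_(b | phi b == c) W x b.

Section Coarsening.
Variables (X B C : finType) (P : X -> R) (phi : B -> C) (W : X -> B -> R).
Hypotheses (PP : is_pmf P) (Wc : is_channel W).
Let P0 x : 0 <= P x. Proof. by case: PP. Qed.
Let W0 x b : 0 <= W x b. Proof. by case: (Wc x). Qed.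

Lemma sum_coarsen (f : X -> C -> R) :
  \sum_x \sum_c P x * coarsen phi W x c * f x c = \sum_x \sum_b P x * W x b * f x (phi b).
Proof.
apply: eq_bigr => x _; rewrite [RHS](partition_big phi xpredT) //=; apply: eq_bigr => c _.
by rewrite -sumrZ -sumlZ; apply: eq_bigr => b /eqP ->.
Qed.

Lemma coarsen_channel : is_channel (coarsen phi W).
Proof.
move=> x; split=> [c|]; first exact: sum_ge0.
by rewrite sumTE -(pmf_sum (Wc x)) [RHS](partition_big phi xpredT).
Qed.

Local Notation r := (outMarg P W).
Local Notation rphi := (outMarg P (coarsen phi W)).

Lemma outMarg_coarsen c : \sum_(b | phi b == c) r b = rphi c.
Proof. by rewrite exchange_big; apply: eq_bigr => x _; rewrite sumrZ. Qed.

Lemma coarsen_support x b : 0 < P x * W x b ->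
  [/\ 0 < P x, 0 < W x b, 0 < coarsen phi W x (phi b), 0 < r b & 0 < rphi (phi b)].
Proof.
move=> pxb; have h1 : W x b <= coarsen phi W x (phi b).
  rewrite /coarsen (bigD1 b) //= -[X in X <= _]Rplus_0_r.
  by apply/Rplus_le_compat_l/sum_ge0.
have h2 := outMarg_ge PP x b Wc; have h3 := outMarg_ge PP x (phi b) coarsen_channel.
have Px := P0 x; have Wx := W0 x b.
have Px' : 0 < P x by nra.
have Wx' : 0 < W x b by nra.
by split=> //; nra.
Qed.

Let p x b := P x * W x b.
(** The law with the same pair (X, phi(B)) in which b is redrawn from phi(B) alone, that is, the
    Markov law X - phi(B) - B. *)
Let q x b := P x * coarsen phi W x (phi b) * (r b / rphi (phi b)).

Let p_ge0 x b : 0 <= p x b. Proof. exact: Rmult_le_pos. Qed.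

Let pq x b : 0 < p x b -> 0 < q x b.
Proof.
move=> /coarsen_support [h1 h2 h3 h4 h5].
by apply: Rmult_lt_0_compat; [exact: Rmult_lt_0_compat | exact: Rdiv_lt_0_compat].
Qed.

Let q_ge0 x b : 0 <= q x b.
Proof.
apply: Rmult_le_pos; first by apply: Rmult_le_pos => //; case: (coarsen_channel x).
have := outMarg_ge0 PP (phi b) coarsen_channel; case=> [h|<-]; last by rewrite /Rdiv Rinv_0; lra.
by apply: Rmult_le_pos; [exact: outMarg_ge0 | left; exact: Rinv_0_lt_compat].
Qed.

Let sum_q : \sum_x \sum_b q x b <= 1.
Proof.
rewrite -(pmf_sum PP); apply: sum_le => x _.
rewrite -[X in _ <= X]Rmult_1_r -(pmf_sum (coarsen_channel x)) -sumrZ.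
rewrite (partition_big phi xpredT) //=; apply: sum_le => c _.
rewrite (eq_bigr (fun b => P x * coarsen phi W x c / rphi c * r b)) => [|b /eqP <-]; last first.
  by rewrite /q /Rdiv; ring.
rewrite sumrZ outMarg_coarsen; case: (outMarg_ge0 PP c coarsen_channel) => [h|<-].
  by right; field; lra.
by rewrite Rmult_0_r; apply: Rmult_le_pos => //; case: (coarsen_channel x).
Qed.

(* I(X; B) - I(X; phi(B)) is the divergence of P(x) W(b|x) from P(x) W(phi(b)|x) r(b|phi(b)). *)
Lemma mutInf_sub_coarsen : mutInf (jointCh P W) - mutInf (jointCh P (coarsen phi W)) =
  \sum_x \sum_b P x * W x b *
    (ln (W x b) - ln (coarsen phi W x (phi b)) - ln (r b / rphi (phi b))).
Proof.
rewrite !mutInfE //; last exact: coarsen_channel.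
rewrite sum_coarsen !pair_bigA -sumrB; apply: eq_bigr => -[x b] _ /=.
case: (p_ge0 x b) => [pxb|]; last by rewrite /p => <-; lra.
by have [h1 h2 h3 h4 h5] := coarsen_support pxb; rewrite ln_quot //; lra.
Qed.

Let gap x b : p x b * (ln (p x b) - ln (q x b)) = P x * W x b *
    (ln (W x b) - ln (coarsen phi W x (phi b)) - ln (r b / rphi (phi b))).
Proof.
case: (p_ge0 x b) => [pxb|p0]; last by rewrite -/(p x b) -p0; lra.
have [h1 h2 h3 h4 h5] := coarsen_support pxb.
rewrite /p /q (ln_mult _ _ (Rmult_lt_0_compat _ _ h1 h3) (Rdiv_lt_0_compat _ _ h4 h5)).
by rewrite (ln_mult _ _ h1 h2) (ln_mult _ _ h1 h3); lra.
Qed.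

(** Subtracting p - q makes every term nonnegative by Gibbs, and the total can only drop because [q]
    has mass at most 1. Nonnegativity of the sum is data processing; if the right side is at most 0,
    every term vanishes and p = q. *)
Let sum_gap : \sum_x \sum_b (p x b * (ln (p x b) - ln (q x b)) - (p x b - q x b))
  <= mutInf (jointCh P W) - mutInf (jointCh P (coarsen phi W)).
Proof.
rewrite mutInf_sub_coarsen.
have -> : \sum_x \sum_b (p x b * (ln (p x b) - ln (q x b)) - (p x b - q x b))
  = \sum_x \sum_b p x b * (ln (p x b) - ln (q x b))
    - (\sum_x \sum_b p x b - \sum_x \sum_b q x b) by rewrite !pair_bigA -!sumrB.
have -> : \sum_x \sum_b p x b = 1 by rewrite sum_channel ?pmf_sum.
under eq_bigr do (under eq_bigr do rewrite gap).
by have := sum_q; lra.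
Qed.

Lemma mutInf_coarsen_le : mutInf (jointCh P (coarsen phi W)) <= mutInf (jointCh P W).
Proof.
suff : 0 <= \sum_x \sum_b (p x b * (ln (p x b) - ln (q x b)) - (p x b - q x b)).
  by have := sum_gap; lra.
apply: sum_ge0 => x _; apply: sum_ge0 => b _.
by have := gibbs (p_ge0 x b) (q_ge0 x b) (@pq x b); lra.
Qed.

Lemma mutInf_coarsen_eq :
  mutInf (jointCh P W) <= mutInf (jointCh P (coarsen phi W)) ->
  forall x b, P x * W x b = P x * coarsen phi W x (phi b) * (r b / rphi (phi b)).
Proof.
move=> le_I x b; apply: (gibbs_eq (p_ge0 x b) (q_ge0 x b) (@pq x b)).
have nn z : 0 <= p z.1 z.2 * (ln (p z.1 z.2) - ln (q z.1 z.2)) - (p z.1 z.2 - q z.1 z.2).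
  by have := gibbs (p_ge0 z.1 z.2) (q_ge0 z.1 z.2) (@pq z.1 z.2); lra.
have := sum_gap; rewrite pair_bigA /= => sg.
by have /= := @sum_eq0P _ _ nn (Rle_trans _ _ _ sg _) (x, b); lra.
Qed.
End Coarsening.

(** * Pair channels, their marginals, and the channel of a two-stage code *)

Section Marginals.
Variables (X Xh : finType) (P : X -> R).
Hypothesis PP : is_pmf P.

Lemma ch1E (Q : X -> Xh * Xh -> R) : ch1 Q = coarsen fst Q.
Proof.
apply: functional_extensionality => x; apply: functional_extensionality => a.
rewrite /ch1 /coarsen sumTE [RHS]big_mkcond sum_pair [RHS](bigD1 a) //=.
rewrite [X in _ + X]big1 => [|a' /negPf aa']; last by rewrite big1 // => b _; rewrite aa'.
by rewrite Rplus_0_r; apply: eq_bigr => b _; rewrite eqxx.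
Qed.

Lemma ch2E (Q : X -> Xh * Xh -> R) : ch2 Q = coarsen snd Q.
Proof.
apply: functional_extensionality => x; apply: functional_extensionality => b.
rewrite /ch2 /coarsen sumTE [RHS]big_mkcond sum_pair [RHS]exchange_big [RHS](bigD1 b) //=.
rewrite [X in _ + X]big1 => [|b' /negPf bb']; last by rewrite big1 // => a _; rewrite bb'.
by rewrite Rplus_0_r; apply: eq_bigr => a _; rewrite eqxx.
Qed.

Lemma ch1_channel (Q : X -> Xh * Xh -> R) : is_channel Q -> is_channel (ch1 Q).
Proof. by rewrite ch1E; exact: coarsen_channel. Qed.

Lemma ch2_channel (Q : X -> Xh * Xh -> R) : is_channel Q -> is_channel (ch2 Q).
Proof. by rewrite ch2E; exact: coarsen_channel. Qed.

Lemma sum_ch1 (Q : X -> Xh * Xh -> R) (f : X -> Xh -> R) :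
  \sum_x \sum_a P x * ch1 Q x a * f x a = \sum_x \sum_ab P x * Q x ab * f x ab.1.
Proof. by rewrite ch1E sum_coarsen. Qed.

Lemma sum_ch2 (Q : X -> Xh * Xh -> R) (f : X -> Xh -> R) :
  \sum_x \sum_b P x * ch2 Q x b * f x b = \sum_x \sum_ab P x * Q x ab * f x ab.2.
Proof. by rewrite ch2E sum_coarsen. Qed.

Lemma expect_ch1 (Q : X -> Xh * Xh -> R) (g : X -> Xh -> R) :
  expect (jointCh P (ch1 Q)) (fun p => g p.1 p.2) =
  expect (jointCh P Q) (fun p => g p.1 p.2.1).
Proof. by rewrite !expectE /= sum_ch1. Qed.

Lemma expect_ch2 (Q : X -> Xh * Xh -> R) (g : X -> Xh -> R) :
  expect (jointCh P (ch2 Q)) (fun p => g p.1 p.2) =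
  expect (jointCh P Q) (fun p => g p.1 p.2.2).
Proof. by rewrite !expectE /= sum_ch2. Qed.

(** One channel has to serve both stages, so the averaged letter is the pair of reproductions. Its
    first marginal is the averaged channel of the first-stage code alone, whose message set has [M1]
    elements; hence I(X; A) is bounded by the first rate and not by the sum. Each of the two rates
    contributes one [eps] to the last bound. *)
Lemma code_channel (g : X -> Xh -> R) n R1 dR D1 E1 D2 E2 eps :
  (0 < n)%N -> two_stage_code P g n R1 dR D1 E1 D2 E2 eps ->
  exists Q : X -> Xh * Xh -> R, is_channel Q /\
    expect (jointCh P Q) (fun p => g p.1 p.2.1) <= D1 + eps /\
    expect (jointCh P Q) (fun p => g p.1 p.2.2) <= D2 + eps /\
    mutInf (jointCh P (ch1 Q)) <= R1 + eps /\
    mutInf (jointCh P Q) <= R1 + dR + 2 * eps.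
Proof.
move=> n0 [M1 [M2 [F1 [F2 [G1 [G2 [r1 [r2 [d1 [d2 _]]]]]]]]]].
have nR0 : 0 < INR n by exact/lt_0_INR/ltP.
pose F (xs : n.-tuple X) := (F1 xs, F2 xs).
pose c (w : 'I_M1 * 'I_M2) i := (tnth (G1 w.1) i, tnth (G2 w) i).
have [Q Qc avg] := avgChannel_exists F c PP n0.
have mean (h : X -> Xh * Xh -> R) : expect (jointCh P Q) (fun p => h p.1 p.2)
    = expect (@prodP X P n) (fun xs => / INR n * \sum_i h (tnth xs i) (c (F xs) i)).
  rewrite expectE avg /expect sumTE -sumrZ; apply: eq_bigr => xs _ /=; lra.
have avgdistE (ys : n.-tuple X -> n.-tuple Xh) :
    expect (@prodP X P n) (fun xs => avgdist g xs (ys xs)) =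
    expect (@prodP X P n) (fun xs => / INR n * \sum_i g (tnth xs i) (tnth (ys xs) i)).
  by rewrite /expect !sumTE; apply: eq_bigr => xs _; rewrite /avgdist sumTE.
have M0 : (0 < M1)%N /\ (0 < M2)%N.
  case/card_gt0P: (pmf_card (prodP_pmf n PP)) => xs _.
  by split; [case: (F1 xs) | case: (F2 xs)] => m; exact: leq_ltn_trans.
have M1R : 0 < INR M1 by apply/lt_0_INR/ltP; case: M0.
have M2R : 0 < INR M2 by apply/lt_0_INR/ltP; case: M0.
have div_le y z : y <= INR n * z -> / INR n * y <= z.
  move=> h; apply: (Rmult_le_reg_l (INR n)) => //.
  by rewrite -Rmult_assoc Rinv_r ?Rmult_1_l //; lra.
exists Q; split=> //; split; last split; last split.
- by rewrite (mean (fun x d => g x d.1)) -avgdistE.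
- by rewrite (mean (fun x d => g x d.2)) -avgdistE.
- have avg1 : isAvgChannel P F1 (fun w i => tnth (G1 w) i) (ch1 Q).
    by move=> f; rewrite sum_ch1 (avg (fun x d => f x d.1)).
  apply: Rle_trans (avgChannel_mutInf_le PP n0 (ch1_channel Qc) avg1) _.
  by apply: div_le; rewrite card_ord.
apply: Rle_trans (avgChannel_mutInf_le PP n0 Qc avg) _; apply: div_le.
rewrite card_prod !card_ord -multE mult_INR ln_mult //; lra.
Qed.

(** [T] is the conditional law of A given B under the joint law. The factor [P x] stays in the
    conclusion because the mutual informations say nothing about [Q x] where [P x = 0]. *)
Lemma markov_of_mutInf_le (Q : X -> Xh * Xh -> R) : is_channel Q ->
  mutInf (jointCh P Q) <= mutInf (jointCh P (ch2 Q)) ->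
  exists2 T : Xh -> Xh -> R, is_channel T &
    forall x a b, P x * Q x (a, b) = P x * (ch2 Q x b * T b a).
Proof.
move=> Qc; rewrite ch2E => /(mutInf_coarsen_eq PP Qc) fact.
set r := outMarg P Q in fact; set s := outMarg P (coarsen snd Q) in fact.
have r0 ab : 0 <= r ab by exact: outMarg_ge0.
have rs b : \sum_a r (a, b) = s b.
  by rewrite exchange_big; apply: eq_bigr => x _; rewrite /= sumrZ -ch2E /ch2 sumTE.
pose T b a := if Rlt_dec 0 (s b) then r (a, b) / s b else \sum_b' r (a, b').
exists T => [b|x a b].
  rewrite /T; case: Rlt_dec => /= sb; split=> [a|].
  - by apply: Rmult_le_pos => //; left; exact: Rinv_0_lt_compat.
  - by rewrite sumTE sumlZ rs Rinv_r; lra.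
  - exact: sum_ge0.
  by rewrite sumTE -sum_pair; apply/pmf_sum/outMarg_pmf.
rewrite fact /= -Rmult_assoc /T; case: Rlt_dec => //= sb.
(* If [s b = 0], then [P x] times the marginal at b is at most [s b], so both sides vanish and the
   default value of [T] does not matter. *)
have -> : P x * coarsen snd Q x b = 0; last by rewrite !Rmult_0_l.
have h1 := outMarg_ge PP x b (coarsen_channel snd Qc); rewrite -/s in h1.
have : 0 <= P x * coarsen snd Q x b; last by lra.
by apply: Rmult_le_pos; [case: PP | case: (coarsen_channel snd Qc x)].
Qed.

End Marginals.

(** * Achievability implies the Markov condition *)

Lemma RDE_le (X Xh : finType) (P : X -> R) (g : X -> Xh -> R) D E r :
  is_pmf P -> is_RDE P g D E r -> r <= ent P - E.
Proof.
move=> PP [lb glb]; have [[y Sy]|none] := classic (exists y, RDE_set P g D E y).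
  apply: Rle_trans (lb _ Sy) _; case: Sy => Q [Qc [_ [hE ->]]].
  by rewrite condEnt_jointCh // in hE; lra.
(* An empty set has no greatest lower bound: [r + 1] would be a lower bound as well. *)
have : r + 1 <= r by apply: glb => y Sy; case: none; exists y.
lra.
Qed.

(** A mutual information at most [r] forces equivocation at least [ent P - r], which is at least
    [E]; so [W] belongs to the set whose infimum is [r]. *)
Lemma mutInf_ge_RDE (X Xh : finType) (P : X -> R) (g : X -> Xh -> R) D E r
    (W : X -> Xh -> R) : is_pmf P -> is_RDE P g D E r -> is_channel W ->
  expect (jointCh P W) (fun p => g p.1 p.2) <= D -> mutInf (jointCh P W) <= r ->
  r <= mutInf (jointCh P W).
Proof.
move=> PP hr Wc hD hI; have hE := RDE_le PP hr; case: hr => lb _; apply: lb.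
by exists W; split=> //; split=> //; split=> //; rewrite condEnt_jointCh //; lra.
Qed.

Lemma eq_mutInf (A B : finType) (p q : A * B -> R) : p =1 q -> mutInf p = mutInf q.
Proof.
move=> pq; rewrite /mutInf /condEnt (eq_ent pq).
rewrite (@eq_ent _ (margL p) (margL q)) => [|a]; last first.
  by rewrite /margL !sumTE; apply: eq_bigr.
rewrite (@eq_ent _ (margR p) (margR q)) // => b.
by rewrite /margR !sumTE; apply: eq_bigr.
Qed.

Section OnlyIf.
Variables (X Xh : finType) (P : X -> R) (g : X -> Xh -> R) (D1 E1 D2 E2 : R).
Hypothesis PP : is_pmf P.

Lemma limit_channel (C : finType) (Q : nat -> X -> C -> R) : (forall k, is_channel (Q k)) ->
  exists phi Q', [/\ forall k, le k (phi k), is_channel Q' &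
    forall x c, Un_cv (fun k => Q (phi k) x c) (Q' x c)].
Proof.
move=> Qc; pose u k (xc : X * C) := Q k xc.1 xc.2.
have u01 k xc : 0 <= u k xc <= 1.
  by split; [case: (Qc k xc.1) => + _; apply | exact: pmf_le1 (Qc k _)].
have [phi [l [hphi hl]]] := bounded_cv_subseq_fin u01.
have hQ x c : Un_cv (fun k => Q (phi k) x c) (l (x, c)) by exact: (hl (x, c)).
exists phi, (fun x c => l (x, c)); split=> // x; split=> [c|].
  by apply: Rle_cv_lim (cv_const 0) (hQ x c) => k; case: (Qc (phi k) x).
rewrite sumTE; apply: (UL_sequence _ _ _ (cv_sum (hQ x))).
by apply: eq_cv (cv_const 1) => k; rewrite (pmf_sum (Qc _ x)).
Qed.

Lemma limit_code_channel R1 R2 :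
  (forall eps, 0 < eps -> exists N : nat, forall n : nat, (N <= n)%N -> (0 < n)%N ->
      two_stage_code P g n R1 (R2 - R1) D1 E1 D2 E2 eps) ->
  exists Q : X -> Xh * Xh -> R, is_channel Q /\
    expect (jointCh P Q) (fun p => g p.1 p.2.1) <= D1 /\
    expect (jointCh P Q) (fun p => g p.1 p.2.2) <= D2 /\
    mutInf (jointCh P (ch1 Q)) <= R1 /\ mutInf (jointCh P Q) <= R2.
Proof.
move=> codes.
have ex k : exists Q : X -> Xh * Xh -> R, is_channel Q /\
    expect (jointCh P Q) (fun p => g p.1 p.2.1) <= D1 + / INR k.+1 /\
    expect (jointCh P Q) (fun p => g p.1 p.2.2) <= D2 + / INR k.+1 /\
    mutInf (jointCh P (ch1 Q)) <= R1 + / INR k.+1 /\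
    mutInf (jointCh P Q) <= R2 + 2 * / INR k.+1.
  have k0 : 0 < / INR k.+1 by apply/Rinv_0_lt_compat/lt_0_INR/Nat.lt_0_succ.
  have [N /(_ N.+1 (leqnSn N) (ltn0Sn N)) code] := codes _ k0.
  have [Q [Qc [d1 [d2 [i1 i2]]]]] := code_channel PP (ltn0Sn N) code.
  by exists Q; do 4!split=> //; lra.
pose Q k := proj1_sig (constructive_indefinite_description _ (ex k)).
have hQ k := proj2_sig (constructive_indefinite_description _ (ex k)); rewrite -/(Q _) in hQ.
have [phi [Q' [hphi Qc' cvQ]]] := limit_channel (fun k => proj1 (hQ k)).
have cvb b c : Un_cv (fun k => b + c * / INR (phi k).+1) b.
  rewrite -[X in Un_cv _ X]Rplus_0_r -[in X in _ + X](Rmult_0_r c).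
  apply: CV_plus; [exact: cv_const | apply: CV_mult; first exact: cv_const].
  exact: (cv_subseq hphi cv_harmonic).
have P0 x : 0 <= P x by case: PP.
have cvJ (C : finType) (W : nat -> X -> C -> R) W' :
    (forall x c, Un_cv (fun k => W k x c) (W' x c)) ->
    forall t, Un_cv (fun k => jointCh P (W k) t) (jointCh P W' t).
  by move=> h [x c]; apply: CV_mult => //; exact: cv_const.
have J0 (C : finType) (W : X -> C -> R) : is_channel W -> forall t, 0 <= jointCh P W t.
  by move=> Wc [x c]; apply: Rmult_le_pos => //; case: (Wc x).
have cvJQ := cvJ _ _ _ cvQ.
exists Q'; split=> //; split; last split; last split.
- apply: (Rle_cv_lim _ (cv_expect _ cvJQ) (cvb D1 1)) => k.
  by case: (hQ (phi k)) => _ [h _]; rewrite Rmult_1_l.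
- apply: (Rle_cv_lim _ (cv_expect _ cvJQ) (cvb D2 1)) => k.
  by case: (hQ (phi k)) => _ [_ [h _]]; rewrite Rmult_1_l.
- have cv1 x a : Un_cv (fun k => ch1 (Q (phi k)) x a) (ch1 Q' x a).
    rewrite /ch1 sumTE; apply: eq_cv (cv_sum (fun b => cvQ x (a, b))) => k.
    by rewrite sumTE.
  have c1 k := ch1_channel (proj1 (hQ (phi k))).
  apply: (Rle_cv_lim _ (cv_mutInf (fun k => J0 _ _ (c1 k)) (cvJ _ _ _ cv1)) (cvb R1 1)) => k.
  by case: (hQ (phi k)) => _ [_ [_ [h _]]]; rewrite Rmult_1_l.
apply: (Rle_cv_lim _ (cv_mutInf (fun k => J0 _ _ (proj1 (hQ (phi k)))) cvJQ) (cvb R2 2)) => k.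
by case: (hQ (phi k)) => _ [_ [_ [_ h]]].
Qed.

Lemma markov_channel_of_achievable : succ_achievable P g D1 E1 D2 E2 ->
  exists Q : X -> Xh * Xh -> R, is_channel Q /\
     expect (jointCh P Q) (fun p => g p.1 p.2.1) <= D1 /\
     expect (jointCh P Q) (fun p => g p.1 p.2.2) <= D2 /\
     is_RDE P g D1 E1 (mutInf (jointCh P (ch1 Q))) /\
     is_RDE P g D2 E2 (mutInf (jointCh P (ch2 Q))) /\
     exists T : Xh -> Xh -> R, is_channel T /\
       forall x a b, Q x (a, b) = ch2 Q x b * T b a.
Proof.
move=> [R1 [R2 [hR1 [hR2 /limit_code_channel [Q [Qc [d1 [d2 [i1 i2]]]]]]]]].
have Q1c := ch1_channel Qc; have Q2c := ch2_channel Qc.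
have i2' : mutInf (jointCh P (ch2 Q)) <= mutInf (jointCh P Q) by rewrite ch2E; exact: mutInf_coarsen_le.
have e1 : mutInf (jointCh P (ch1 Q)) = R1.
  by apply: Rle_antisym => //; apply: (mutInf_ge_RDE PP hR1) => //; rewrite expect_ch1.
have e2 : mutInf (jointCh P (ch2 Q)) = R2.
  apply: Rle_antisym; first lra.
  by apply: (mutInf_ge_RDE PP hR2) => //; [rewrite expect_ch2 | lra].
have [|T Tc fact] := markov_of_mutInf_le PP Qc; first lra.
(* [Q] factorises only where [P x] is positive, whereas the factorisation is claimed for every [x].
   [Q'] factorises by construction and has the same joint law with [P], so distortions and mutual
   informations carry over. *)
pose Q' x ab := ch2 Q x ab.2 * T ab.2 ab.1.
have ch2Q' x b : ch2 Q' x b = ch2 Q x b.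
  by rewrite {1}/ch2 sumTE /Q' /= sumrZ (pmf_sum (Tc b)) Rmult_1_r.
have Qc' : is_channel Q'.
  move=> x; split=> [ab|].
    by apply: Rmult_le_pos; [case: (Q2c x) | case: (Tc ab.2)].
  rewrite sumTE sum_pair exchange_big /= -(pmf_sum (Q2c x)).
  by apply: eq_bigr => b _; rewrite /Q' /= sumrZ (pmf_sum (Tc b)) Rmult_1_r.
have J' : jointCh P Q' =1 jointCh P Q by case=> x [a b]; rewrite /jointCh /Q' /= fact.
have J1 : jointCh P (ch1 Q') =1 jointCh P (ch1 Q).
  case=> x a; rewrite /jointCh /ch1 /= !sumTE -!sumrZ; apply: eq_bigr => b _.
  exact: (J' (x, (a, b))).
have J2 : jointCh P (ch2 Q') =1 jointCh P (ch2 Q) by case=> x b; rewrite /jointCh /= ch2Q'.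
exists Q'; split=> //; split; first by rewrite /expect sumTE; under eq_bigr do rewrite J'; rewrite -sumTE.
split; first by rewrite /expect sumTE; under eq_bigr do rewrite J'; rewrite -sumTE.
rewrite (eq_mutInf J1) (eq_mutInf J2) e1 e2; do 2!split=> //.
by exists T; split=> // x a b; rewrite ch2Q'.
Qed.
End OnlyIf.

(** * Covering *)

Lemma exp_pow x n : exp x ^ n = exp (INR n * x).
Proof.
elim: n => [|n IH]; first by rewrite /= Rmult_0_l exp_0.
by rewrite /= IH -exp_plus -/(INR n.+1) S_INR; congr exp; ring.
Qed.

(** Convexity of exp from its tangent at the intermediate point [- (t * y)]: in the weighted average
    of the tangent at 0 and at [- y] the linear terms cancel. *)
Lemma exp_chord t y : 0 <= t <= 1 -> exp (- (t * y)) <= 1 - t + t * exp (- y).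
Proof.
move=> t01; set c := - (t * y); have ec := exp_pos c.
have tangent a : exp c * (1 + (a - c)) <= exp a.
  have -> : exp a = exp c * exp (a - c) by rewrite -exp_plus; congr exp; ring.
  by apply: Rmult_le_compat_l; [lra | exact: exp_ineq1_le].
have := tangent 0; rewrite exp_0 => h0; have h1 := tangent (- y).
have h2 : (1 - t) * (exp c * (1 + (0 - c))) <= (1 - t) * 1 by apply: Rmult_le_compat_l; lra.
have h3 : t * (exp c * (1 + (- y - c))) <= t * exp (- y) by apply: Rmult_le_compat_l; lra.
suff : exp c = (1 - t) * (exp c * (1 + (0 - c))) + t * (exp c * (1 + (- y - c))) by lra.
by move: (exp c) => e; rewrite /c; ring.
Qed.

(** From exp (- y) >= 1 - y follows exp y <= 1 / (1 - y), and (1 + y + 2 y^2) (1 - y) = 1 + y^2 (1 -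
    2 y) >= 1. *)
Lemma exp_le_quadratic y : Rabs y <= / 2 -> exp y <= 1 + y + 2 * (y * y).
Proof.
move=> hy; have {hy} [h1 h2] : - / 2 <= y <= / 2 by split_Rabs; lra.
have e := exp_ineq1_le (- y); have ey := exp_pos y.
have ee : exp y * exp (- y) = 1 by rewrite -exp_plus Rplus_opp_r exp_0.
have h3 : exp y * (1 - y) <= 1 by rewrite -[X in _ <= X]ee; apply: Rmult_le_compat_l; lra.
have h4 : 1 <= (1 + y + 2 * (y * y)) * (1 - y) by nra.
apply: (Rmult_le_reg_r (1 - y)); lra.
Qed.

Lemma pmf_mean_attained (B : finType) (q f : B -> R) :
  is_pmf q -> exists b, f b <= \sum_b q b * f b.
Proof.
move=> qP; have q0 b : 0 <= q b by case: qP.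
set m := \sum_b q b * f b; apply: NNPP => no.
have fm b : m < f b by apply: Rnot_le_lt => h; apply: no; exists b.
have z0 : \sum_b q b * (f b - m) <= 0.
  under eq_bigr do rewrite Rmult_minus_distr_l.
  by rewrite sumrB sumlZ (pmf_sum qP) -/m; lra.
have qz b : q b = 0.
  have z : q b * (f b - m) = 0.
    apply: (sum_eq0P (F := fun b => q b * (f b - m)) _ z0) => b'.
    by apply: Rmult_le_pos => //; have := fm b'; lra.
  by case: (Rmult_integral _ _ z) => //; have := fm b; lra.
by have := pmf_sum qP; rewrite big1 //; lra.
Qed.

(* Derandomised i.i.d. covering by the method of conditional expectations: some next codeword
   does not increase the conditional expectation of the uncovered weight. *)
Lemma greedy_cover (X B : finType) (w : X -> R) (q : B -> R) (S : X -> B -> bool) M :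
  is_pmf q -> exists L : M.-tuple B,
    \sum_(x | ~~ has (S x) L) w x <= \sum_x w x * (\sum_(b | ~~ S x b) q b) ^ M.
Proof.
move=> qP; elim: M w => [|M IH] w.
  by exists [tuple]; right; apply: eq_bigr => x _; rewrite Rmult_1_r.
pose u x := \sum_(b | ~~ S x b) q b.
have [b hb] := pmf_mean_attained (fun b => \sum_(x | ~~ S x b) w x * u x ^ M) qP.
have [L hL] := IH (fun x => if ~~ S x b then w x else 0).
exists [tuple of b :: L].
have -> : \sum_(x | ~~ has (S x) [tuple of b :: L]) w x =
          \sum_(x | ~~ has (S x) L) (if ~~ S x b then w x else 0).
  rewrite [LHS]big_mkcond [RHS]big_mkcond; apply: eq_bigr => x _ /=; rewrite negb_or.
  by case: (S x b); case: (has (S x) L).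
apply: Rle_trans hL _.
have -> : \sum_x (if ~~ S x b then w x else 0) * (\sum_(b0 | ~~ S x b0) q b0) ^ M
        = \sum_(x | ~~ S x b) w x * u x ^ M.
  rewrite [RHS]big_mkcond; apply: eq_bigr => x _; rewrite -/(u x).
  by case: (S x b) => //=; rewrite Rmult_0_l.
apply: Rle_trans hb _; right.
transitivity (\sum_b' \sum_x (if ~~ S x b' then q b' * (w x * u x ^ M) else 0)).
  by apply: eq_bigr => b' _; rewrite -big_mkcond sumrZ.
rewrite exchange_big; apply: eq_bigr => x _ /=; rewrite -big_mkcond sumlZ -/(u x) /=; ring.
Qed.

(** If [J] puts a share t of [w x] on [S x], the last hypothesis gives [S x] a [q]-mass of at least
    t / K. All M draws miss it with probability at most (1 - t / K)^M <= exp (- t M / K) <= 1 - t +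
    t exp (- M / K), the last step by convexity. The weight [w] is not normalised because the
    satellite stage uses it for one fixed cloud centre. *)
Lemma covering (X B : finType) (w : X -> R) (J : X -> B -> R) (q : B -> R)
    (S : X -> B -> bool) K M :
  is_pmf q -> (forall x b, 0 <= J x b) -> (forall x, \sum_b J x b <= w x) -> 0 < K ->
  (forall x b, S x b -> J x b <= K * (w x * q b)) ->
  exists L : M.-tuple B, \sum_(x | ~~ has (S x) L) w x <=
    \sum_x (w x - \sum_(b | S x b) J x b) + exp (- (INR M / K)) * \sum_x w x.
Proof.
move=> qP J0 Jw K0 JK; have [L hL] := greedy_cover w S M qP; exists L.
apply: Rle_trans hL _; rewrite -sumrZ -sumrD; apply: sum_le => x _.
set s := \sum_(b | S x b) J x b; set u := \sum_(b | ~~ S x b) q b.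
have q0 b : 0 <= q b by case: qP.
have s0 : 0 <= s by exact: sum_ge0.
have sw : s <= w x by apply: Rle_trans (Jw x); exact: sum_le_subset.
have u0 : 0 <= u by exact: sum_ge0.
have e0 := exp_pos (- (INR M / K)).
have sv : s <= K * (w x * (1 - u)).
  have -> : 1 - u = \sum_(b | S x b) q b.
    by rewrite -(pmf_sum qP) (bigID (S x)) /= -/u; ring.
  by rewrite -!sumrZ; apply: sum_le => b /JK.
case: (Rle_lt_or_eq_dec 0 (w x)) => [|w0|w0]; first lra; last first.
  by rewrite -w0 in sw *; lra.
pose t := s / w x.
have t01 : 0 <= t <= 1.
  split; first by apply: Rmult_le_pos => //; left; exact: Rinv_0_lt_compat.
  by apply: (Rmult_le_reg_r (w x)) => //; rewrite /t /Rdiv Rmult_assoc Rinv_l; lra.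
have wt : s = w x * t by rewrite /t; field; lra.
have ut : u <= exp (- (t / K)).
  apply: Rle_trans (exp_ineq1_le _).
  suff : t / K <= 1 - u by lra.
  apply: (Rmult_le_reg_l (K * w x)); first exact: Rmult_lt_0_compat.
  have -> : K * w x * (t / K) = s by rewrite wt; field; lra.
  lra.
have uM : u ^ M <= 1 - t + t * exp (- (INR M / K)).
  apply: Rle_trans (exp_chord (INR M / K) t01); apply: Rle_trans (pow_incr _ _ M (conj u0 ut)) _.
  by rewrite exp_pow; right; congr exp; field; lra.
have : w x * u ^ M <= w x * (1 - t + t * exp (- (INR M / K))) by apply: Rmult_le_compat_l; lra.
have : w x * (t * exp (- (INR M / K))) <= w x * (1 * exp (- (INR M / K))).
  by apply: Rmult_le_compat_l; [lra | apply: Rmult_le_compat_r; lra].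
lra.
Qed.

(* The covering bound twice: a satellite codebook for every possible cloud centre [a], then a
   codebook of cloud centres for the pairs (x, a) that the satellites cover. *)
Lemma two_stage_covering (X A B : finType) (w : X -> R) (V1 : X -> A -> R)
    (V : X -> A -> B -> R) (q1 : A -> R) (q2 : A -> B -> R) (S : X -> A -> B -> bool)
    K1 K2 M1 M2 :
  is_pmf w -> is_channel V1 -> (forall x a b, 0 <= V x a b) ->
  (forall x a, \sum_b V x a b = V1 x a) -> is_pmf q1 -> is_channel q2 ->
  0 < K1 -> 0 < K2 ->
  (forall x a b, S x a b -> V1 x a <= K1 * q1 a) ->
  (forall x a b, S x a b -> V x a b <= K2 * (V1 x a * q2 a b)) ->
  exists (LA : M1.-tuple A) (LB : A -> M2.-tuple B),
    \sum_(x | ~~ has (fun a => has (S x a) (LB a)) LA) w x <=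
    \sum_x \sum_a \sum_(b | ~~ S x a b) w x * V x a b
    + exp (- (INR M1 / K1)) + exp (- (INR M2 / K2)).
Proof.
move=> wP V1c V0 sumV q1P q2c K10 K20 SV1 SV.
have w0 x : 0 <= w x by case: wP.
have V10 x a : 0 <= V1 x a by case: (V1c x).
have ex a : exists L : M2.-tuple B, \sum_(x | ~~ has (S x a) L) w x * V1 x a <=
    \sum_x \sum_(b | ~~ S x a b) w x * V x a b
    + exp (- (INR M2 / K2)) * \sum_x w x * V1 x a.
  have [x b|x|//|x b Sx|L hL] := @covering _ _ (fun x => w x * V1 x a)
      (fun x b => w x * V x a b) (q2 a) (fun x b => S x a b) K2 M2 (q2c a).
  - exact: Rmult_le_pos.
  - by rewrite sumrZ sumV; lra.
  - have := Rmult_le_compat_l (w x) _ _ (w0 x) (SV _ _ _ Sx); lra.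
  exists L; apply: Rle_trans hL _; apply/Rplus_le_compat_r; right; apply: eq_bigr => x _.
  by rewrite -sumV -sumrZ (bigID (S x a)) /=; ring.
pose LB a := proj1_sig (constructive_indefinite_description _ (ex a)).
have hLB a := proj2_sig (constructive_indefinite_description _ (ex a)); rewrite -/(LB _) in hLB.
have [x a|x|//|x a|LA hLA] := @covering _ _ w (fun x a => w x * V1 x a) q1
    (fun x a => has (S x a) (LB a)) K1 M1 q1P.
- exact: Rmult_le_pos.
- by rewrite sumrZ (pmf_sum (V1c x)); lra.
- case/hasP => b _ /SV1 h; have := Rmult_le_compat_l (w x) _ _ (w0 x) h; lra.
exists LA, LB; apply: Rle_trans hLA _; rewrite (pmf_sum wP) Rmult_1_r.
suff : \sum_x (w x - \sum_(a | has (S x a) (LB a)) w x * V1 x a) <=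
    \sum_x \sum_a \sum_(b | ~~ S x a b) w x * V x a b + exp (- (INR M2 / K2)) by lra.
(* What the cloud stage cannot reach is, for each [a], the mass missed by the satellites of [a]; the
   satellite bounds can then be summed over [a]. *)
have -> : \sum_x (w x - \sum_(a | has (S x a) (LB a)) w x * V1 x a)
        = \sum_a \sum_(x | ~~ has (S x a) (LB a)) w x * V1 x a.
  under [in RHS]eq_bigr do rewrite big_mkcond.
  rewrite [RHS]exchange_big; apply: eq_bigr => x _; rewrite -big_mkcond /=.
  rewrite -{1}[w x]Rmult_1_r -(pmf_sum (V1c x)) -sumrZ.
  by rewrite (bigID (fun a => has (S x a) (LB a))) /=; ring.
apply: Rle_trans (sum_le (fun a _ => hLB a)) _; rewrite sumrD sumrZ.
have -> : \sum_a \sum_x w x * V1 x a = 1 by rewrite exchange_big /= sum_channel ?pmf_sum.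
by rewrite Rmult_1_r [X in X + _]exchange_big; right.
Qed.

(** * Exponential tail bounds *)

Lemma chernoff_rate (Z : finType) (p f : Z -> R) m d : is_pmf p ->
  \sum_z p z * f z <= m -> 0 < d ->
  exists2 t, 0 < t & 0 <= \sum_z p z * exp (t * (f z - (m + d))) < 1.
Proof.
move=> pP mean d0; have p0 z : 0 <= p z by case: pP.
pose C := d + \sum_z Rabs (f z - (m + d)).
have hC z : Rabs (f z - (m + d)) <= C.
  have := sum_ge_term (F := fun z => Rabs (f z - (m + d))) z (fun _ => Rabs_pos _).
  by rewrite /C; lra.
have Cd : d <= C by have := sum_ge0 (P := xpredT) (fun z _ => Rabs_pos (f z - (m + d))); rewrite /C; lra.
(* The quadratic bound on exp gives at most 1 - t d + 2 t^2 C^2, and this [t] turns it into 1 - t d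
   / 2. The summand [d] in [C] keeps [t * C] within the range of that bound. *)
pose t := d / (4 * (C * C)).
have C2 : 0 < 4 * (C * C) by nra.
have t0 : 0 < t by exact: Rdiv_lt_0_compat.
have tCC : t * (C * C) = d / 4 by rewrite /t; field; lra.
have tC : t * C <= / 2 by nra.
exists t => //; split.
  by apply: sum_ge0 => z _; apply: Rmult_le_pos => //; left; exact: exp_pos.
apply: (Rle_lt_trans _ (\sum_z (p z * (1 + 2 * (t * t * (C * C)) - t * (m + d)) + t * (p z * f z)))).
  apply: sum_le => z _.
  have -> : p z * (1 + 2 * (t * t * (C * C)) - t * (m + d)) + t * (p z * f z)
    = p z * (1 + t * (f z - (m + d)) + 2 * (t * t * (C * C))) by ring.
  apply: Rmult_le_compat_l => //; have := hC z; set y := f z - (m + d) => hy.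
  apply: Rle_trans (exp_le_quadratic _) _.
    by rewrite Rabs_mult Rabs_pos_eq; [nra | lra].
  have : y * y <= C * C by split_Rabs; nra.
  by move=> h; have : t * t * (y * y) <= t * t * (C * C); [apply: Rmult_le_compat_l; nra | lra].
rewrite sumrD sumlZ sumrZ (pmf_sum pP); nra.
Qed.

Lemma sum3_prod (X A B : finType) n (h : X -> A -> B -> R) :
  \sum_(xs : n.-tuple X) \sum_(ys : n.-tuple A) \sum_(zs : n.-tuple B)
    \prod_(i < n) h (tnth xs i) (tnth ys i) (tnth zs i)
  = (\sum_x \sum_a \sum_b h x a b) ^ n.
Proof.
rewrite -prod_const -(sum_tuple_prod (fun _ x => \sum_a \sum_b h x a b)).
apply: eq_bigr => xs _.
rewrite -(sum_tuple_prod (fun i a => \sum_b h (tnth xs i) a b)); apply: eq_bigr => ys _.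
exact: (sum_tuple_prod (fun i b => h (tnth xs i) (tnth ys i) b)).
Qed.

(** The rate [rho] is fixed before n and [bad]. The event has to imply a large sum only on sequences
    with positive letter probabilities, since only there is the logarithm of a product of
    probabilities the sum of the logarithms. *)
Lemma tail_bound (X A B : finType) (p f : X -> A -> B -> R) m d :
  (forall x a b, 0 <= p x a b) -> \sum_x \sum_a \sum_b p x a b = 1 ->
  \sum_x \sum_a \sum_b p x a b * f x a b <= m -> 0 < d ->
  exists2 rho, 0 <= rho < 1 &
  forall n (bad : n.-tuple X -> n.-tuple A -> n.-tuple B -> bool),
    (forall xs ys zs, (forall i, 0 < p (tnth xs i) (tnth ys i) (tnth zs i)) -> bad xs ys zs ->
       INR n * (m + d) < \sum_i f (tnth xs i) (tnth ys i) (tnth zs i)) ->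
    \sum_xs \sum_ys \sum_(zs | bad xs ys zs) \prod_(i < n) p (tnth xs i) (tnth ys i) (tnth zs i)
    <= rho ^ n.
Proof.
move=> p0 p1 mean d0; pose pz (z : X * (A * B)) := p z.1 z.2.1 z.2.2.
have pzP : is_pmf pz.
  split=> [z|]; first exact: p0.
  by rewrite sumTE sum_pair -p1; apply: eq_bigr => x _; rewrite sum_pair.
have [|t t0] := @chernoff_rate _ pz (fun z => f z.1 z.2.1 z.2.2) m d pzP _ d0.
  by rewrite sum_pair; under eq_bigr do rewrite sum_pair.
set rho := (X in 0 <= X < 1) => hrho; exists rho => // n bad hbad.
have -> : rho = \sum_x \sum_a \sum_b p x a b * exp (t * (f x a b - (m + d))).
  by rewrite /rho sum_pair; apply: eq_bigr => x _; rewrite sum_pair.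
rewrite -sum3_prod; apply: sum_le => xs _; apply: sum_le => ys _.
rewrite big_mkcond; apply: sum_le => zs _; rewrite big_split /=.
set pp := \prod_(i < n) p _ _ _; have pp0 : 0 <= pp by exact: prod_ge0.
rewrite -exp_sum sumrZ sumrB sum_const card_ord.
case: ifP => [bz|_]; last by apply: Rmult_le_pos => //; left; exact: exp_pos.
case: pp0 => [ppos|<-]; last by lra.
have h := hbad _ _ _ (fun i => prod_pos_factor i (fun _ => p0 _ _ _) ppos) bz.
rewrite -[X in X <= _]Rmult_1_r; apply: Rmult_le_compat_l; first lra.
apply: Rle_trans (exp_ineq1_le _); set s := \sum_i _ in h *.
have : 0 < t * (s - INR n * (m + d)) by apply: Rmult_lt_0_compat; lra.
lra.
Qed.

(** Since exp y >= 1, rounding it up to an integer at most doubles it, at a cost of ln 2 in the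
    exponent. *)
Lemma codebook_size y z : 0 <= y -> ln 2 <= z ->
  exists M : nat, exp y <= INR M /\ ln (INR M) <= y + z.
Proof.
move=> y0 z2; have [h1 h2] := archimed (exp y); have e1 := exp_ineq1_le y.
have [|M eM] := IZN (up (exp y)); first by apply: le_IZR; lra.
have e : INR M = IZR (up (exp y)) by rewrite INR_IZR_INZ -eM.
exists M; rewrite e; split; first lra.
apply: (Rle_trans _ (ln (exp y * 2))).
  have : IZR (up (exp y)) <= exp y * 2 by lra.
  by case=> [lt|->]; [left; apply: ln_increasing; lra | right].
by rewrite ln_mult ?ln_exp; lra.
Qed.

(** The message is a function of the source, so the joint entropy is that of the source, n H(X), and
    the entropy of the message is at most ln |W|. *)
Lemma equivocation_ge (X W : finType) (P : X -> R) n (F : n.-tuple X -> W) : is_pmf P ->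
  INR n * ent P - ln (INR #|W|) <= condEnt (detJoint (@prodP X P n) F).
Proof.
move=> PP; have pP := prodP_pmf n PP.
have sum_det xs (h : R -> R) : h 0 = 0 ->
    \sum_w h (detJoint (@prodP X P n) F (xs, w)) = h (prodP P xs).
  move=> h0; rewrite (bigD1 (F xs)) //= big1 => [|w]; rewrite /detJoint /= ?eqxx.
    by rewrite Rplus_0_r.
  by rewrite eq_sym => /negPf ->.
have margP : is_pmf (margR (detJoint (@prodP X P n) F)).
  split=> [w|]; rewrite /margR ?sumTE.
    apply: sum_ge0 => xs _; rewrite /detJoint; case: ifP => _; [exact: prodP_ge0 | lra].
  under eq_bigr do rewrite sumTE.
  by rewrite exchange_big /= -(pmf_sum pP); apply: eq_bigr => xs _; rewrite (sum_det xs id).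
have := ent_le_card margP; rewrite /condEnt.
have -> : ent (detJoint (@prodP X P n) F) = INR n * ent P; last by lra.
rewrite !entE sum_pair.
rewrite (eq_bigr (fun xs => \sum_i prodP P xs * ln (P (tnth xs i)))) => [|xs _]; last first.
  rewrite (sum_det xs (fun x => x * ln x)); last by rewrite Rmult_0_l.
  rewrite sumrZ; case: (prodP_ge0 xs PP) => [pos|<-]; last by rewrite !Rmult_0_l.
  rewrite {2}prodPE ln_prod // => i.
  apply: (prod_pos_factor (F := fun i => P (tnth xs i))); last by rewrite -prodPE.
  by move=> j; case: PP.
rewrite exchange_big /= (eq_bigr (fun=> \sum_x P x * ln (P x))) => [|i _].
  by rewrite sum_const card_ord; ring.
rewrite (partition_big (fun xs : n.-tuple X => tnth xs i) xpredT) //=.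
apply: eq_bigr => x _; rewrite -(prodP_marginal i x PP) -sumlZ.
by apply: eq_bigr => xs /eqP ->; rewrite prodP_marginal.
Qed.

(** * Random coding *)

(** A boolean test, so that typicality can index sums and be searched with [has] and [[pick]]. *)
Definition leR (x y : R) : bool := if Rle_dec x y then true else false.

Lemma leRP x y : reflect (x <= y) (leR x y).
Proof. by rewrite /leR; case: Rle_dec => h; constructor. Qed.

Lemma prod_channel (A B : finType) (W : A -> B -> R) n : is_channel W ->
  is_channel (fun (xs : n.-tuple A) (ys : n.-tuple B) => \prod_(i < n) W (tnth xs i) (tnth ys i)).
Proof.
move=> Wc xs; split=> [ys|]; first by apply: prod_ge0 => i; case: (Wc (tnth xs i)).
rewrite sumTE (sum_tuple_prod (fun i b => W (tnth xs i) b)) big1 // => i _.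
exact: (pmf_sum (Wc _)).
Qed.

Lemma covering_decay n M y d : 0 < d -> exp (INR n * (y + 2 * d)) <= INR M ->
  exp (- (INR M / exp (INR n * (y + d)))) <= exp (- d) ^ n.
Proof.
move=> d0 hM; rewrite exp_pow.
set K := exp (INR n * (y + d)); have K0 : 0 < K by exact: exp_pos.
have h : INR n * d <= INR M / K.
  apply: (Rle_trans _ (exp (INR n * d))); first by have := exp_ineq1_le (INR n * d); lra.
  apply: (Rmult_le_reg_r K) => //; rewrite /Rdiv Rmult_assoc Rinv_l; last lra.
  by rewrite Rmult_1_r -exp_plus; apply: Rle_trans hM; right; congr exp; ring.
by case: (Req_dec (INR M / K) (INR n * d)) => [->|ne];
  [right; congr exp; ring | left; apply: exp_increasing; lra].
Qed.

Section Achievability.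
Variables (X Xh : finType) (P : X -> R) (g : X -> Xh -> R).
Variable Q : X -> Xh * Xh -> R.
Hypotheses (PP : is_pmf P) (Qc : is_channel Q).

Local Notation V1 := (coarsen fst Q).
Local Notation q1 := (outMarg P V1).
Let V1c : is_channel V1 := coarsen_channel fst Qc.
Let P0 x : 0 <= P x. Proof. by case: PP. Qed.
Let Q0 x ab : 0 <= Q x ab. Proof. by case: (Qc x). Qed.

Variables (R1 R2 D1 D2 : R).
Hypotheses (R1E : mutInf (jointCh P V1) = R1) (R2E : mutInf (jointCh P Q) = R2).
Hypotheses (dist1 : expect (jointCh P Q) (fun p => g p.1 p.2.1) <= D1)
           (dist2 : expect (jointCh P Q) (fun p => g p.1 p.2.2) <= D2).

(** The satellite law p(b|a), with the law of B as default where [q1 a = 0]. *)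
Let q2 a b := if Rlt_dec 0 (q1 a) then outMarg P Q (a, b) / q1 a
              else \sum_a' outMarg P Q (a', b).

Let q2_channel : is_channel q2.
Proof.
have r0 ab : 0 <= outMarg P Q ab by exact: outMarg_ge0.
move=> a; rewrite /q2; case: Rlt_dec => /= q1a; split=> [b|].
- by apply: Rmult_le_pos => //; left; exact: Rinv_0_lt_compat.
- rewrite sumTE sumlZ; have -> : \sum_b outMarg P Q (a, b) = q1 a; last by rewrite Rinv_r; lra.
  by rewrite exchange_big; apply: eq_bigr => x _; rewrite sumrZ -ch1E /ch1 sumTE.
- exact: sum_ge0.
by rewrite sumTE exchange_big -sum_pair; apply/pmf_sum/outMarg_pmf.
Qed.

Let p x a b := P x * Q x (a, b).

Let p_ge0 x a b : 0 <= p x a b. Proof. exact: Rmult_le_pos. Qed.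

Let support x a b : 0 < p x a b ->
  [/\ 0 < Q x (a, b), 0 < V1 x a, 0 < q1 a & 0 < q2 a b].
Proof.
move=> /(@coarsen_support _ _ _ _ fst _ PP Qc) [_ h2 h3 h4 h5]; split=> //.
by rewrite /q2; case: Rlt_dec => //= _; exact: Rdiv_lt_0_compat.
Qed.

Let meanE (f : X -> Xh * Xh -> R) :
  \sum_x \sum_a \sum_b p x a b * f x (a, b) = \sum_x \sum_ab P x * Q x ab * f x ab.
Proof. by apply: eq_bigr => x _; rewrite sum_pair. Qed.

Let mean1 : \sum_x \sum_a \sum_b p x a b * (ln (V1 x a) - ln (q1 a)) <= R1.
Proof.
rewrite (meanE (fun x ab => ln (V1 x ab.1) - ln (q1 ab.1))) -R1E mutInfE //.
by rewrite (sum_coarsen _ fst _ (fun x a => ln (V1 x a) - ln (q1 a))); right.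
Qed.

(** The conditional information density has mean I(X; A, B) - I(X; A), by the divergence formula for
    the coarsening [fst]; on the support [q1 a] is positive, so [q2] is the true quotient. *)
Let mean2 : \sum_x \sum_a \sum_b p x a b * (ln (Q x (a, b)) - ln (V1 x a) - ln (q2 a b))
  <= R2 - R1.
Proof.
rewrite (meanE (fun x ab => ln (Q x ab) - ln (V1 x ab.1) - ln (q2 ab.1 ab.2))) -R1E -R2E.
rewrite (mutInf_sub_coarsen _ PP Qc); right; apply: eq_bigr => x _; apply: eq_bigr => -[a b] _ /=.
case: (p_ge0 x a b) => [pp|]; last by rewrite /p => <-; lra.
by have [_ _ h _] := support pp; rewrite {1}/q2; case: Rlt_dec.
Qed.

(** An upper bound on the information density, written with products instead of logarithms: it makes
    sense at probability 0 and is literally the hypothesis of the covering bound with K = exp (n (R1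
    + d)). *)
Definition cloud_ok d n (xs : n.-tuple X) (ys : n.-tuple Xh) : bool :=
  leR (\prod_(i < n) V1 (tnth xs i) (tnth ys i))
      (exp (INR n * (R1 + d)) * \prod_(i < n) q1 (tnth ys i)).

Definition satellite_ok d n (xs : n.-tuple X) (ys zs : n.-tuple Xh) : bool :=
  leR (\prod_(i < n) Q (tnth xs i) (tnth ys i, tnth zs i))
      (exp (INR n * (R2 - R1 + d)) * (\prod_(i < n) V1 (tnth xs i) (tnth ys i) *
                                      \prod_(i < n) q2 (tnth ys i) (tnth zs i))).

Definition dist_ok D d n (xs : n.-tuple X) (ys : n.-tuple Xh) : bool :=
  leR (\sum_i g (tnth xs i) (tnth ys i)) (INR n * (D + d)).

Definition typical d n (xs : n.-tuple X) (ys zs : n.-tuple Xh) : bool :=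
  [&& cloud_ok d xs ys, satellite_ok d xs ys zs, dist_ok D1 d xs ys & dist_ok D2 d xs zs].

Lemma atypical_mass d : 0 < d -> exists2 rho, 0 <= rho < 1 & forall n,
  \sum_(xs : n.-tuple X) \sum_(ys : n.-tuple Xh) \sum_(zs : n.-tuple Xh | ~~ typical d xs ys zs)
    \prod_(i < n) p (tnth xs i) (tnth ys i) (tnth zs i) <= 4 * rho ^ n.
Proof.
move=> d0.
have p1 : \sum_x \sum_a \sum_b p x a b = 1.
  rewrite -(pmf_sum PP); apply: eq_bigr => x _.
  by rewrite -(sum_pair (fun ab => P x * Q x ab)) sumrZ (pmf_sum (Qc x)) Rmult_1_r.
have mean3 : \sum_x \sum_a \sum_b p x a b * g x a <= D1.
  by rewrite (meanE (fun x ab => g x ab.1)); move: dist1; rewrite expectE.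
have mean4 : \sum_x \sum_a \sum_b p x a b * g x b <= D2.
  by rewrite (meanE (fun x ab => g x ab.2)); move: dist2; rewrite expectE.
have [r1 r1b t1] := tail_bound p_ge0 p1 mean1 d0.
have [r2 r2b t2] := tail_bound p_ge0 p1 mean2 d0.
have [r3 r3b t3] := tail_bound (f := fun x a _ => g x a) p_ge0 p1 mean3 d0.
have [r4 r4b t4] := tail_bound (f := fun x _ b => g x b) p_ge0 p1 mean4 d0.
pose rho := Rmax (Rmax r1 r2) (Rmax r3 r4).
have [m1 m2 m3 m4] : [/\ r1 <= rho, r2 <= rho, r3 <= rho & r4 <= rho].
  have := Rmax_l (Rmax r1 r2) (Rmax r3 r4); have := Rmax_r (Rmax r1 r2) (Rmax r3 r4).
  have := Rmax_l r1 r2; have := Rmax_r r1 r2; have := Rmax_l r3 r4; have := Rmax_r r3 r4.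
  by rewrite -/rho; split; lra.
exists rho; first by split; [lra | apply: Rmax_lub_lt; apply: Rmax_lub_lt; lra].
move=> n.
have pw r : 0 <= r < 1 -> r <= rho -> r ^ n <= rho ^ n by move=> *; apply: pow_incr; lra.
have b1 := t1 n (fun xs ys _ => ~~ cloud_ok d xs ys).
have b2 := t2 n (fun xs ys zs => ~~ satellite_ok d xs ys zs).
have b3 := t3 n (fun xs ys _ => ~~ dist_ok D1 d xs ys).
have b4 := t4 n (fun xs _ zs => ~~ dist_ok D2 d xs zs).
suff split4 : \sum_(xs : n.-tuple X) \sum_(ys : n.-tuple Xh) \sum_(zs : n.-tuple Xh | ~~ typical d xs ys zs)
    \prod_(i < n) p (tnth xs i) (tnth ys i) (tnth zs i) <= r1 ^ n + r2 ^ n + r3 ^ n + r4 ^ n.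
  by have := pw _ r1b m1; have := pw _ r2b m2; have := pw _ r3b m3; have := pw _ r4b m4; lra.
apply: Rle_trans (Rplus_le_compat _ _ _ _ (Rplus_le_compat _ _ _ _ (Rplus_le_compat _ _ _ _
  (b1 _) (b2 _)) (b3 _)) (b4 _)).
- rewrite -!sumrD; apply: sum_le => xs _; rewrite -!sumrD; apply: sum_le => ys _.
  rewrite ![\big[_/_]_(zs | ~~ _) _]big_mkcond -!sumrD; apply: sum_le => zs _.
  have := @prod_ge0 n _ (fun i => p_ge0 (tnth xs i) (tnth ys i) (tnth zs i)).
  set pi := \prod_(i < n) _ => pi0.
  rewrite /typical.
  by case: (cloud_ok d xs ys); case: (satellite_ok d xs ys zs); case: (dist_ok D1 d xs ys);
    case: (dist_ok D2 d xs zs) => /=; lra.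
- move=> xs ys zs pos /leRP /Rnot_le_lt lt.
  have V1p i : 0 < V1 (tnth xs i) (tnth ys i) by case: (support (pos i)).
  have q1p i : 0 < q1 (tnth ys i) by case: (support (pos i)).
  rewrite sumrB -!ln_prod //; set y := INR n * _.
  have := ln_increasing _ _ _ lt; rewrite ln_mult ?ln_exp -/y; first 1 last.
  + exact: exp_pos.
  + exact: prod_gt0.
  by move=> h; have := h (Rmult_lt_0_compat _ _ (exp_pos _) (prod_gt0 q1p)); lra.
- move=> xs ys zs pos /leRP /Rnot_le_lt lt.
  have Qp i : 0 < Q (tnth xs i) (tnth ys i, tnth zs i) by case: (support (pos i)).
  have V1p i : 0 < V1 (tnth xs i) (tnth ys i) by case: (support (pos i)).
  have q2p i : 0 < q2 (tnth ys i) (tnth zs i) by case: (support (pos i)).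
  have VV := prod_gt0 V1p; have qq := prod_gt0 q2p; have Vq := Rmult_lt_0_compat _ _ VV qq.
  rewrite !sumrB -!ln_prod //; set y := INR n * _.
  have := ln_increasing _ _ (Rmult_lt_0_compat _ _ (exp_pos y) Vq) lt.
  rewrite (ln_mult _ _ (exp_pos y) Vq) ln_exp (ln_mult _ _ VV qq); lra.
- by move=> xs ys zs _ /leRP /Rnot_le_lt.
by move=> xs ys zs _ /leRP /Rnot_le_lt.
Qed.

(** The densities are allowed a slack [d] and the codebooks [2 * d]; the remaining [d] drives the
    covering terms. The constant 6 is 4 for the atypical mass plus 1 for each covering term. *)
Lemma typical_codebooks d : 0 < d -> exists2 rho, 0 <= rho < 1 & forall n M1 M2,
  exp (INR n * (R1 + 2 * d)) <= INR M1 -> exp (INR n * (R2 - R1 + 2 * d)) <= INR M2 ->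
  exists (LA : M1.-tuple (n.-tuple Xh)) (LB : n.-tuple Xh -> M2.-tuple (n.-tuple Xh)),
    \big[Rplus/0]_(xs : n.-tuple X | ~~ has (fun ys => has (typical d xs ys) (LB ys)) LA)
      prodP P xs <= 6 * rho ^ n.
Proof.
move=> d0; have [rho0 rho0b mass] := atypical_mass d0.
have ed : 0 < exp (- d) < 1.
  by split; [exact: exp_pos | rewrite -exp_0; apply: exp_increasing; lra].
pose rho := Rmax rho0 (exp (- d)).
have m1 : rho0 <= rho by exact: Rmax_l.
have m2 : exp (- d) <= rho by exact: Rmax_r.
exists rho; first by split; [lra | apply: Rmax_lub_lt; lra].
move=> n M1 M2 hM1 hM2.
have q1P : is_pmf q1 by exact: outMarg_pmf.
have [xs ys zs|xs ys|||||xs ys zs|xs ys zs|LA [LB hL]] := @two_stage_covering _ _ _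
    (@prodP X P n) (fun xs ys => \prod_(i < n) V1 (tnth xs i) (tnth ys i))
    (fun xs ys zs => \prod_(i < n) Q (tnth xs i) (tnth ys i, tnth zs i))
    (@prodP Xh q1 n) (fun ys zs => \prod_(i < n) q2 (tnth ys i) (tnth zs i))
    (@typical d n) (exp (INR n * (R1 + d))) (exp (INR n * (R2 - R1 + d))) M1 M2
    (prodP_pmf n PP) (prod_channel V1c).
- exact: prod_ge0.
- rewrite (sum_tuple_prod (fun i b => Q (tnth xs i) (tnth ys i, b))); apply: eq_bigr => i _.
  by rewrite -ch1E /ch1 sumTE.
- exact: prodP_pmf.
- exact: prod_channel.
- exact: exp_pos.
- exact: exp_pos.
- by case/and4P => /leRP h _ _ _; rewrite prodPE.
- by case/and4P => _ /leRP.
exists LA, LB; apply: Rle_trans hL _.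
have := covering_decay d0 hM1; have := covering_decay d0 hM2.
have : exp (- d) ^ n <= rho ^ n by apply: pow_incr; lra.
have : rho0 ^ n <= rho ^ n by apply: pow_incr; lra.
have := mass n.
set s := (X in X <= 4 * _); set s' := (X in _ -> _ -> _ -> _ -> X + _ + _ <= _).
have -> : s' = s; last lra.
apply: eq_bigr => xs _; apply: eq_bigr => ys _; apply: eq_bigr => zs _.
by rewrite prodPE -big_split.
Qed.

Let gmax := \sum_x \sum_a Rabs (g x a).

Let avgdist_le n (xs : n.-tuple X) ys : (0 < n)%N -> avgdist g xs ys <= gmax.
Proof.
move=> n0; have nR : 0 < INR n by exact/lt_0_INR/ltP.
rewrite /avgdist sumTE; apply: (Rmult_le_reg_l (INR n)) => //.
rewrite -Rmult_assoc Rinv_r ?Rmult_1_l; last lra.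
have -> : INR n * gmax = \sum_(i < n) gmax by rewrite sum_const card_ord.
apply: sum_le => i _.
apply: Rle_trans (Rle_abs _) _.
apply: Rle_trans (sum_ge_term (F := fun a => Rabs (g (tnth xs i) a)) (tnth ys i) _) _.
  by move=> a; exact: Rabs_pos.
apply: (sum_ge_term (F := fun x => \sum_a Rabs (g x a))) => x.
by apply: sum_ge0 => a _; exact: Rabs_pos.
Qed.

Let dist_ok_avg D d n (xs : n.-tuple X) ys : (0 < n)%N ->
  dist_ok D d xs ys -> avgdist g xs ys <= D + d.
Proof.
move=> n0 /leRP h; have nR : 0 < INR n by exact/lt_0_INR/ltP.
rewrite /avgdist sumTE; apply: (Rmult_le_reg_l (INR n)) => //.
by rewrite -Rmult_assoc Rinv_r ?Rmult_1_l; lra.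
Qed.

Let mean_of_hits (T : finType) (w f : T -> R) (hit : T -> bool) D : is_pmf w ->
  (forall t, f t <= gmax) -> (forall t, hit t -> f t <= D) ->
  expect w f <= D + (\sum_(t | ~~ hit t) w t) * (gmax + Rabs D).
Proof.
move=> wP fg fD; have w0 t : 0 <= w t by case: wP.
rewrite /expect sumTE; set c := gmax + Rabs D.
have -> : D + (\sum_(t | ~~ hit t) w t) * c =
          \sum_t (w t * D + (if ~~ hit t then w t * c else 0)).
  by rewrite sumrD sumlZ (pmf_sum wP) -big_mkcond sumlZ; ring.
apply: sum_le => t _; case: (boolP (hit t)) => [/fD h|_] /=.
  by have := Rmult_le_compat_l _ _ _ (w0 t) h; lra.
rewrite -Rmult_plus_distr_l; apply: Rmult_le_compat_l => //.
by have := fg t; rewrite /c; split_Rabs; lra.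
Qed.

Hypotheses (R1_ge0 : 0 <= R1) (R12 : R1 <= R2).

Lemma codes_of_channel eps : 0 < eps -> exists N : nat, forall n, (N <= n)%N -> (0 < n)%N ->
  exists (M1 M2 : nat) (F1 : n.-tuple X -> 'I_M1) (F2 : n.-tuple X -> 'I_M2)
         (G1 : 'I_M1 -> n.-tuple Xh) (G2 : 'I_M1 * 'I_M2 -> n.-tuple Xh),
    ln (INR M1) <= INR n * (R1 + eps) /\
    ln (INR M2) <= INR n * (R2 - R1 + eps) /\
    expect (@prodP X P n) (fun xs => avgdist g xs (G1 (F1 xs))) <= D1 + eps /\
    expect (@prodP X P n) (fun xs => avgdist g xs (G2 (F1 xs, F2 xs))) <= D2 + eps.
Proof.
(* A rate spends [2 * d] on the codebook and [d] on rounding; a distortion spends [d] on typicality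
   and [d] on the missed sequences. *)
move=> eps0; pose d := eps / 3; have d0 : 0 < d by rewrite /d; lra.
have [rho rhob books] := typical_codebooks d0.
have g0 : 0 <= gmax.
  by apply: sum_ge0 => x _; apply: sum_ge0 => a _; exact: Rabs_pos.
pose C := gmax + Rabs (D1 + d) + Rabs (D2 + d) + 1.
have C0 : 0 < C by rewrite /C; have := Rabs_pos (D1 + d); have := Rabs_pos (D2 + d); lra.
have [||N1 hN1] := @pow_lt_1_zero rho _ (d / (6 * C)) _; first by split_Rabs; lra.
  by apply: Rdiv_lt_0_compat; lra.
have [N2 hN2] := INR_archimed d (ln 2) d0.
exists (N1 + N2)%N => n hn n0.
have nN1 : le N1 n by apply/leP; apply: leq_trans hn; exact: leq_addr.
have nN2 : le N2 n by apply/leP; apply: leq_trans hn; exact: leq_addl.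
have nR : 0 < INR n by exact/lt_0_INR/ltP.
have nd : ln 2 <= INR n * d.
  by have := Rmult_le_compat_r d _ _ (Rlt_le _ _ d0) (le_INR _ _ nN2); lra.
have rn : 6 * rho ^ n * C <= d.
  have := hN1 n nN1; rewrite Rabs_pos_eq; last by apply: pow_le; lra.
  move=> h; have -> : d = 6 * (d / (6 * C)) * C by field; lra.
  by apply: Rmult_le_compat_r; lra.
have [|M1 [lo1 up1]] := @codebook_size (INR n * (R1 + 2 * d)) _ _ nd.
  by apply: Rmult_le_pos; lra.
have [|M2 [lo2 up2]] := @codebook_size (INR n * (R2 - R1 + 2 * d)) _ _ nd.
  by apply: Rmult_le_pos; lra.
have [LA [LB miss]] := books n M1 M2 lo1 lo2.
have pos M y : exp y <= INR M -> (0 < M)%N.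
  by case: M => // /Rle_not_lt []; exact: exp_pos.
(* The satellite codebook is selected by the cloud centre itself, which the second decoder recovers
   from the first message. *)
pose G1 m := tnth LA m; pose G2 (mk : 'I_M1 * 'I_M2) := tnth (LB (G1 mk.1)) mk.2.
(* Both indices are searched jointly, since the chosen cloud centre must have a suitable satellite;
   an uncovered sequence gets the indices 0. *)
pose enc xs := odflt (Ordinal (pos _ _ lo1), Ordinal (pos _ _ lo2))
  [pick mk | typical d xs (G1 mk.1) (G2 mk)].
have hit xs : has (fun ys => has (typical d xs ys) (LB ys)) LA ->
    typical d xs (G1 (enc xs).1) (G2 (enc xs)).
  rewrite /enc; case: pickP => [//|none] /hasP [_ /tnthP [m ->]] /hasP [_ /tnthP [k ->]] typ.
  by have := none (m, k); rewrite /= /G2 /= typ.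
have eps3 : eps = 3 * d by rewrite /d; lra.
have mean D f : (forall xs, f xs <= gmax) ->
    (forall xs, has (fun ys => has (typical d xs ys) (LB ys)) LA -> f xs <= D + d) ->
    Rabs (D + d) <= C - gmax -> expect (@prodP X P n) f <= D + eps.
  move=> fg fD hC; apply: Rle_trans (mean_of_hits (prodP_pmf n PP) fg fD) _.
  set s := \big[_/_]_(_ | _) _ in miss *.
  have : s * (gmax + Rabs (D + d)) <= 6 * rho ^ n * C.
    apply: Rmult_le_compat; [|have := Rabs_pos (D + d); lra | by [] | lra].
    by apply: sum_ge0 => xs _; exact: prodP_ge0.
  lra.
exists M1, M2, (fun xs => (enc xs).1), (fun xs => (enc xs).2), G1, G2.
split; first by apply: Rle_trans up1 _; rewrite eps3; right; ring.
split; first by apply: Rle_trans up2 _; rewrite eps3; right; ring.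
split; apply: mean => [xs|xs /hit|].
- exact: avgdist_le.
- by case/and4P => _ _ h _; exact: dist_ok_avg.
- by rewrite /C; have := Rabs_pos (D2 + d); lra.
- exact: avgdist_le.
- by rewrite -surjective_pairing => /and4P [_ _ _]; exact: dist_ok_avg.
by rewrite /C; have := Rabs_pos (D1 + d); lra.
Qed.

End Achievability.

(** * From the Markov condition to codes *)

Lemma mutInf_ge0 (X B : finType) (P : X -> R) (W : X -> B -> R) :
  is_pmf P -> is_channel W -> 0 <= mutInf (jointCh P W).
Proof.
(* Data processing through the constant map to [unit], whose output carries no information. *)
move=> PP Wc; apply: Rle_trans (mutInf_coarsen_le (fun=> tt) PP Wc).
rewrite mutInfE //; last exact: coarsen_channel.
have c1 x u : coarsen (fun=> tt) W x u = 1.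
  by case: u; rewrite /coarsen -(pmf_sum (Wc x)); apply: eq_bigl => b; rewrite eqxx.
have r1 u : outMarg P (coarsen (fun=> tt) W) u = 1.
  by rewrite -(pmf_sum PP); apply: eq_bigr => x _; rewrite c1 Rmult_1_r.
by apply: sum_ge0 => x _; apply: sum_ge0 => u _; rewrite c1 r1; lra.
Qed.

(** Under the factorisation, Q(a, b|x) / Q(b|x) and r(a, b) / r(b) both equal T(a|b), so every term
    of the divergence is 0. *)
Lemma mutInf_markov (X Xh : finType) (P : X -> R) (Q : X -> Xh * Xh -> R) (T : Xh -> Xh -> R) :
  is_pmf P -> is_channel Q -> (forall x a b, Q x (a, b) = ch2 Q x b * T b a) ->
  mutInf (jointCh P Q) = mutInf (jointCh P (ch2 Q)).
Proof.
move=> PP Qc; rewrite ch2E => fact.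
suff : mutInf (jointCh P Q) - mutInf (jointCh P (coarsen snd Q)) = 0 by lra.
rewrite (mutInf_sub_coarsen _ PP Qc) big1 // => x _; rewrite big1 // => -[a b] _ /=.
have : 0 <= P x * Q x (a, b) by apply: Rmult_le_pos; [case: PP | case: (Qc x)].
case=> [pos|<-]; last by lra.
have [_ h2 h3 _ h5] := @coarsen_support _ _ _ _ snd _ PP Qc _ _ pos.
rewrite /= in h3 h5.
have Tp : 0 < T b a by rewrite fact in h2; nra.
have -> : outMarg P Q (a, b) = outMarg P (coarsen snd Q) b * T b a.
  by rewrite -sumlZ; apply: eq_bigr => y _; rewrite fact; ring.
have -> : outMarg P (coarsen snd Q) b * T b a / outMarg P (coarsen snd Q) b = T b a.
  by field; lra.
by rewrite fact ln_mult //; lra.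
Qed.

Lemma achievable_of_markov_channel (X Xh : finType) (P : X -> R) (g : X -> Xh -> R)
    (D1 E1 D2 E2 : R) (Q : X -> Xh * Xh -> R) (T : Xh -> Xh -> R) :
  is_pmf P -> is_channel Q ->
  expect (jointCh P Q) (fun p => g p.1 p.2.1) <= D1 ->
  expect (jointCh P Q) (fun p => g p.1 p.2.2) <= D2 ->
  is_RDE P g D1 E1 (mutInf (jointCh P (ch1 Q))) ->
  is_RDE P g D2 E2 (mutInf (jointCh P (ch2 Q))) ->
  (forall x a b, Q x (a, b) = ch2 Q x b * T b a) ->
  succ_achievable P g D1 E1 D2 E2.
Proof.
move=> PP Qc d1 d2 rde1 rde2 fact.
exists (mutInf (jointCh P (ch1 Q))), (mutInf (jointCh P (ch2 Q))); do 2!split=> //.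
have le1 := RDE_le PP rde1; have le2 := RDE_le PP rde2.
have R2E := mutInf_markov PP Qc fact.
have R1_0 := mutInf_ge0 PP (ch1_channel Qc).
have R12 : mutInf (jointCh P (ch1 Q)) <= mutInf (jointCh P (ch2 Q)).
  by rewrite -R2E ch1E; exact: mutInf_coarsen_le.
have R1E : mutInf (jointCh P (coarsen fst Q)) = mutInf (jointCh P (ch1 Q)) by rewrite ch1E.
move: le1 le2 R2E R1_0 R12 R1E.
set R1 := mutInf (jointCh P (ch1 Q)); set R2 := mutInf (jointCh P (ch2 Q)).
move=> le1 le2 R2E R1_0 R12 R1E eps eps0.
(* The second equivocation is charged for the slack of both rates, hence half of [eps] for each. *)
have eps2 : 0 < eps / 2 by lra.
have [N codes] := codes_of_channel PP Qc R1E R2E d1 d2 R1_0 R12 eps2.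
exists N => n hN n0.
have [M1 [M2 [F1 [F2 [G1 [G2 [r1 [r2 [c1 c2]]]]]]]]] := codes n hN n0.
have nR : 0 < INR n by exact/lt_0_INR/ltP.
have ne : 0 < INR n * eps by exact: Rmult_lt_0_compat.
have M0 : (0 < M1)%N /\ (0 < M2)%N.
  case/card_gt0P: (pmf_card (prodP_pmf n PP)) => xs _.
  by split; [case: (F1 xs) | case: (F2 xs)] => m; exact: leq_ltn_trans.
have M1R : 0 < INR M1 by apply/lt_0_INR/ltP; case: M0.
have M2R : 0 < INR M2 by apply/lt_0_INR/ltP; case: M0.
have le_div y z : INR n * y <= z -> y <= / INR n * z.
  move=> h; apply: (Rmult_le_reg_l (INR n)) => //.
  by rewrite -Rmult_assoc Rinv_r ?Rmult_1_l //; lra.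
exists M1, M2, F1, F2, G1, G2; split; first lra; split; first lra.
split; first lra; split; first lra; split; apply: le_div.
  have := equivocation_ge F1 PP; rewrite card_ord.
  have := Rmult_le_compat_l (INR n) _ _ (Rlt_le _ _ nR) le1; lra.
have := equivocation_ge (fun xs => (F1 xs, F2 xs)) PP.
rewrite card_prod !card_ord -multE mult_INR ln_mult // => h; apply: Rle_trans h.
have := Rmult_le_compat_l (INR n) _ _ (Rlt_le _ _ nR) le2; lra.
Qed.

Theorem theorem3 (X Xh : finType) (P : X -> R) (g : X -> Xh -> R) (D1 E1 D2 E2 : R) :
  is_pmf P -> D2 < D1 -> E2 < E1 ->
  (succ_achievable P g D1 E1 D2 E2 <->
   exists Q : X -> Xh * Xh -> R, is_channel Q /\
     expect (jointCh P Q) (fun p => g p.1 p.2.1) <= D1 /\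
     expect (jointCh P Q) (fun p => g p.1 p.2.2) <= D2 /\
     is_RDE P g D1 E1 (mutInf (jointCh P (ch1 Q))) /\
     is_RDE P g D2 E2 (mutInf (jointCh P (ch2 Q))) /\
     exists T : Xh -> Xh -> R, is_channel T /\
       forall x a b, Q x (a, b) = ch2 Q x b * T b a).
Proof.
move=> PP _ _; split; first exact: markov_channel_of_achievable.
move=> [Q [Qc [d1 [d2 [rde1 [rde2 [T [_ fact]]]]]]]].
exact: achievable_of_markov_channel fact.
Qed.
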